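(* Let $n,g$ be integers such that $\lceil \frac{3g}{2}\rceil-1\le n$. If $G$ is a connected bicyclic graph of order $n$ with girth $g$ and $\alpha\in[\frac12,1)$, then $$\rho_\alpha(G)\le \rho_\alpha\Big(C_{\lfloor \frac g2\rfloor,\lceil \frac g2\rceil,\lceil \frac g2\rceil}^{\,n-\lceil \frac{3g}{2}\rceil+1}\Big),$$ and equality holds if and only if $G\cong C_{\lfloor \frac g2\rfloor,\lceil \frac g2\rceil,\lceil \frac g2\rceil}^{\,n-\lceil \frac{3g}{2}\rceil+1}$.
   Context: All graphs are finite, simple and connected. For a graph $G$ with adjacency matrix $A(G)$ and diagonal degree matrix $D(G)$, put $A_\alpha(G)=\alpha D(G)+(1-\alpha)A(G)$; $\rho_\alpha(G)$ denotes the largest eigenvalue of $A_\alpha(G)$. A connected graph is bicyclic if its number of edges equals its number of vertices plus one. For integers $p,q,r\ge1$, at most one of which equals $1$, $C(p,q,r)$ is the (theta) graph obtained from three vertex-disjoint paths of lengths $p,q,r$ (numbers of edges) by identifying their three initial vertices into one vertex and their three terminal vertices into one vertex. For $t\ge0$, $C_{p,q,r}^{t}$ is the bicyclic graph obtained from $C(p,q,r)$ by attaching $t$ pendant vertices to one of its two vertices of degree $3$. *)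

(* Defs.v *)
From mathcomp Require Import all_boot all_order all_algebra.
From mathcomp Require Import classical_sets reals.

Set Implicit Arguments.
Unset Strict Implicit.
Unset Printing Implicit Defensive.

Import Order.TTheory GRing.Theory Num.Theory.

Record sgraph := SGraph {
  vertex :> finType;
  adj : rel vertex;
  adj_sym : symmetric adj;
  adj_irrefl : irreflexive adj }.

Definition edges (G : sgraph) : {set {set G}} :=
  [set E | [exists x, exists y, adj x y && (E == [set x; y])]].

Definition degree (G : sgraph) (x : G) : nat := #|[set y | adj x y]|.

Definition connected_graph (G : sgraph) : Prop :=
  0 < #|G| /\ forall x y : G, connect (@adj G) x y.

Definition bicyclic (G : sgraph) : Prop :=
  connected_graph G /\ #|edges G| = #|G|.+1.

(* The lower bound excludes the 2-cycles x, y that [ucycle] accepts for every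
   edge xy. *)
Definition graph_cycle (G : sgraph) (c : seq G) : Prop :=
  3 <= size c /\ ucycle (@adj G) c.

Definition has_girth (G : sgraph) (g : nat) : Prop :=
  (exists2 c : seq G, graph_cycle c & size c = g) /\
  (forall c : seq G, graph_cycle c -> g <= size c).

Definition isomorphic (G H : sgraph) : Prop :=
  exists2 f : G -> H, bijective f & forall x y, adj (f x) (f y) = adj x y.

Section Theta.
Variables p q r : nat.

Definition theta_len (i : 'I_3) : nat := tnth [tuple p; q; r] i.

(* [inl false] and [inl true] are the identified initial and terminal vertices;
   [inr (Tagged _ j)] is the interior vertex at distance j + 1 from the initial
   vertex along one of the three paths. *)
Definition theta_vertex : finType :=
  (bool + {i : 'I_3 & 'I_(theta_len i).-1})%type.

Definition theta_path (i : 'I_3) (k : nat) : theta_vertex :=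
  if k is k'.+1 then
    if (insub k' : option 'I_(theta_len i).-1) is Some j
    then inr (Tagged (fun h => 'I_(theta_len h).-1) j)
    else inl true
  else inl false.

Definition theta_arc : rel theta_vertex := fun x y =>
  [exists i : 'I_3, exists k : 'I_(theta_len i),
     (x == theta_path i k) && (y == theta_path i k.+1)].

Definition theta_adj : rel theta_vertex := fun x y =>
  theta_arc x y || theta_arc y x.

Lemma theta_adj_sym : symmetric theta_adj.
Proof. by move=> x y; rewrite /theta_adj orbC. Qed.

Lemma theta_path_neq (i : 'I_3) (k : nat) : k < theta_len i ->
  theta_path i k != theta_path i k.+1.
Proof.
case: k => [|k] lt_k /=; first by case: insubP.
have lt_k' : k < (theta_len i).-1 by rewrite -ltnS prednK ?(leq_ltn_trans _ lt_k).
rewrite (insubT (fun m => m < _) lt_k').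
case: insubP => // j _ def_j; apply/eqP => -[] /eqP.
rewrite eq_Tagged /= => /eqP def_k; move: def_j.
by rewrite -def_k /= => /n_Sn.
Qed.

Lemma theta_adj_irrefl : irreflexive theta_adj.
Proof.
move=> x; rewrite /theta_adj orbb; apply/existsP => -[i /existsP[k]].
case/andP=> /eqP -> ; exact/negP/theta_path_neq.
Qed.

Definition theta : sgraph := SGraph theta_adj_sym theta_adj_irrefl.

Definition theta_initial : theta := inl false.

End Theta.

Section Pendant.
Variables (G : sgraph) (v : G) (t : nat).

Definition pendant_adj : rel (G + 'I_t)%type := fun x y =>
  match x, y with
  | inl a, inl b => adj a b
  | inl a, inr _ | inr _, inl a => a == v
  | inr _, inr _ => false
  end.

Lemma pendant_adj_sym : symmetric pendant_adj.
Proof. by move=> [x|x] [y|y] //=; apply: adj_sym. Qed.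

Lemma pendant_adj_irrefl : irreflexive pendant_adj.
Proof. by move=> [x|x] //=; apply: adj_irrefl. Qed.

Definition attach_pendants : sgraph :=
  SGraph pendant_adj_sym pendant_adj_irrefl.

End Pendant.

(* Reversing the three paths exchanges the two vertices of degree 3, so the
   choice of the initial one does not matter up to isomorphism. *)
Definition theta_pendant (p q r t : nat) : sgraph :=
  attach_pendants (theta_initial p q r) t.

Local Open Scope ring_scope.

Definition adj_mx (R : realType) (G : sgraph) : 'M[R]_#|G| :=
  \matrix_(i, j) (adj (enum_val i) (enum_val j))%:R.

Definition degree_mx (R : realType) (G : sgraph) : 'M[R]_#|G| :=
  diag_mx (\row_i (degree (enum_val i))%:R).

Definition alpha_mx (R : realType) (alpha : R) (G : sgraph) : 'M[R]_#|G| :=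
  alpha *: degree_mx R G + (1 - alpha) *: adj_mx R G.

(* For a symmetric matrix of positive order the set of real eigenvalues is
   finite and nonempty, so that the supremum is a maximum. *)
Definition largest_eigenvalue (R : realType) (n : nat) (M : 'M[R]_n) : R :=
  sup [set a | eigenvalue M a]%classic.

Lemma largest_eigenvalueE (R : realType) (n : nat) (M : 'M[R]_n) (a : R) :
  eigenvalue M a -> (forall b, eigenvalue M b -> b <= a) ->
  largest_eigenvalue M = a.
Proof.
move=> Ma maxa; apply/eqP; rewrite eq_le; apply/andP; split.
  by apply: ge_sup; [exists a | move=> b; apply: maxa].
by apply: ub_le_sup => //; exists a => b; apply: maxa.
Qed.

Definition rho (R : realType) (alpha : R) (G : sgraph) : R :=
  largest_eigenvalue (alpha_mx alpha G).

(* Main.v *)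
Require Import Defs.
From mathcomp Require Import boolp classical_sets reals topology normedtype derive.
From mathcomp Require Import all_boot all_order all_algebra.
From mathcomp Require Import ring lra zify.
Set Implicit Arguments.
Unset Strict Implicit.
Unset Printing Implicit Defensive.

Import Order.TTheory GRing.Theory Num.Theory.
Import numFieldNormedType.Exports.
Local Open Scope ring_scope.

(** Call a connected graph with [n + 1] edges and all cycles of length at least
    [g] a candidate.  Choose a candidate [G] with maximal [rho] on the given
    vertex set and let [x] be its positive eigenvector.  If moving the edges from
    [b] to some vertices over to [a] yields a candidate again, the Rayleigh
    quotient of [x] shows that [x a < x b].

    Hence two opposite moves cannot both yield candidates.  Contracting an edge,
    or identifying two neighbours of a vertex, and attaching the vertex that is
    lost as a pendant one are such moves in either direction.  So in [G] every edge
    between non-leaves lies on a cycle of length [g], any two edges between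
    non-leaves with a common end lie on a cycle of length at most [g + 1], and
    all leaves have the same neighbour [w].  Counting degrees, the non-leaves form
    a theta graph, and the two cycle conditions force its path lengths.

    It remains to see that [w] is a vertex of degree 3 of the theta graph.
    Otherwise move all leaves to one of these vertices, [u], and test with the
    values of [x] reversed along the path from [u] to [w].  This gains because
    along the paths [x] obeys a linear recurrence that is steep enough: if it were
    not, [x] would decay both from [u] to the other vertex of degree 3 and
    back.  The hypothesis [1 / 2 <= alpha] enters in this last step. *)

(** * Rayleigh quotients of real symmetric matrices *)

Section QuadraticForm.
Variables (R : realType) (n : nat).
Implicit Types (M : 'M[R]_n) (u v : 'rV[R]_n).

(** Row vectors are used because [eigenvalue] refers to the action on rows; [qform 1%:M] serves as
    the squared Euclidean norm. *)
Definition qform M u : R := (u *m M *m u^T) 0 0.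

Lemma qform1 u : qform 1%:M u = \sum_i u 0 i ^+ 2.
Proof.
by rewrite /qform mulmx1 mxE; apply: eq_bigr => i _; rewrite mxE expr2.
Qed.

Lemma qform1_ge0 u : 0 <= qform 1%:M u.
Proof. by rewrite qform1; apply: sumr_ge0 => i _; apply: sqr_ge0. Qed.

Lemma qform1_eq0 u : (qform 1%:M u == 0) = (u == 0).
Proof.
rewrite qform1 psumr_eq0 => [|i _]; last exact: sqr_ge0.
apply/allP/eqP => [u0|-> i _]; last by rewrite mxE expr0n /= eqxx.
by apply/rowP => i; rewrite mxE; have := u0 i (mem_index_enum i); rewrite /= sqrf_eq0 => /eqP.
Qed.

Lemma qformZ M c u : qform M (c *: u) = c ^+ 2 * qform M u.
Proof. by rewrite /qform linearZ /= -!scalemxAl -scalemxAr !mxE mulrA. Qed.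

Lemma qformBl M M' u : qform (M - M') u = qform M u - qform M' u.
Proof. by rewrite /qform mulmxBr mulmxBl !mxE. Qed.

Lemma qform_scalar c u : qform c%:M u = c * qform 1%:M u.
Proof.
by rewrite /qform mul_mx_scalar -scalemxAl mxE mulmx1.
Qed.

Lemma continuous_qform M : continuous (qform M).
Proof.
have -> : qform M = fun u => \sum_i (\sum_j u 0 j * M j i) * u 0 i.
  apply/funext => u; rewrite /qform mxE; apply: eq_bigr => i _.
  by rewrite !mxE.
apply: continuous_big => [|i _ u]; first exact: add_continuous.
apply: continuousM; last exact: coord_continuous.
move: u; apply: continuous_big => [|j _ u]; first exact: add_continuous.
apply: continuousM; [exact: coord_continuous | exact: cst_continuous].
Qed.

(* Otherwise the form would be negative at [u - t * (u *m M)] for small [t > 0]. *)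
Lemma psd_qform_eq0 M u : M^T = M -> (forall v, 0 <= qform M v) ->
  qform M u = 0 -> u *m M = 0.
Proof.
move=> symM psdM Mu0; have [w defw] : {w | u *m M = w} by exists (u *m M).
rewrite defw; apply/eqP; rewrite -qform1_eq0.
set a := qform _ w; set q := qform M w.
have defa : (u *m M *m w^T) 0 0 = a by rewrite defw /a /qform mulmx1.
have defa' : (w *m M *m u^T) 0 0 = a.
  have -> : w *m M *m u^T = (u *m M *m w^T)^T.
    by rewrite !trmx_mul trmxK symM mulmxA.
  by rewrite mxE.
have expand t : qform M (u + t *: w) = 2 * t * a + t ^+ 2 * q.
  have -> : qform M (u + t *: w) = qform M u + t * (w *m M *m u^T) 0 0
      + t * ((u *m M *m w^T) 0 0 + t * qform M w).
    rewrite /qform linearD linearZ !mulmxDr !mulmxDl -!scalemxAl -!scalemxAr.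
    by rewrite !mxE !mulrDr.
  by rewrite Mu0 defa defa' -/q; ring.
have a_ge0 : 0 <= a := qform1_ge0 w.
have q_ge0 : 0 <= q := psdM w.
rewrite eq_le a_ge0 andbT leNgt; apply/negP => a_gt0.
(* The expansion is smallest at [t = - a / q]; the added 1 keeps the denominator positive when
   [q = 0] and still makes the value negative. *)
have := psdM (u + (- a / (q + 1)) *: w); rewrite expand.
have q1_gt0 : 0 < q + 1 by rewrite ltr_wpDl.
have q2_gt0 : 0 < q + 2 by rewrite ltr_wpDl.
have -> : 2 * (- a / (q + 1)) * a + (- a / (q + 1)) ^+ 2 * q =
    - (a ^+ 2 * (q + 2)) / (q + 1) ^+ 2 by field; rewrite gt_eqF.
rewrite leNgt mulNr oppr_lt0 divr_gt0 ?exprn_gt0 //.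
by rewrite mulr_gt0 ?exprn_gt0.
Qed.

(** The form is continuous, so it attains a maximum on the compact unit sphere, and homogeneity
    carries the bound to all vectors. The cross-multiplied form also covers [u = 0]. *)
Lemma exists_max_qform M : (0 < n)%N ->
  exists2 v, v != 0 & forall u, qform M u * qform 1%:M v <= qform M v * qform 1%:M u.
Proof.
move=> n_gt0; pose S := [set v | qform 1%:M v = 1]%classic.
have S0 : S !=set0%classic.
  exists (delta_mx 0 (Ordinal n_gt0)).
  rewrite /S /= qform1 (bigD1 (Ordinal n_gt0)) //= big1 => [|i /negbTE ne_i].
    by rewrite mxE !eqxx expr1n addr0.
  by rewrite mxE ne_i andbF expr0n.
have cS : compact S.
  apply: bounded_closed_compact.
    exists 1; split; first exact: num_real.
    move=> x x_gt1 v /= Sv; rewrite /S /= qform1 in Sv.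
    rewrite [leLHS]/Num.norm /= mx_normrE; apply/bigmax_leP; split=> [|[i j] _ /=].
      exact: ltW (lt_trans ltr01 x_gt1).
    rewrite ord1; apply: le_trans (ltW x_gt1).
    suff: v 0 j ^+ 2 <= 1.
      by rewrite -real_normK ?num_real // -[1 in X in X -> _](expr1n _ 2) ler_pXn2r ?nnegrE.
    rewrite -Sv (bigD1 j) //= lerDl; apply: sumr_ge0 => k _; exact: sqr_ge0.
  have := @preimage_closed _ _ (qform 1%:M) [set x : R | x = 1]%classic.
  apply; last exact: closed_eq.
  by move=> u _; apply: continuous_qform.
have [v /set_mem Sv maxv] := EVT_max_rV S0 cS (continuous_subspaceT (@continuous_qform M)).
exists v.
  by rewrite -qform1_eq0 Sv oner_eq0.
move=> u; rewrite Sv mulr1; have [->|nz_u] := eqVneq u 0.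
  by rewrite -(scale0r (0 : 'rV[R]_n)) !qformZ expr0n !mul0r mulr0.
have u_gt0 : 0 < qform 1%:M u by rewrite lt_def qform1_eq0 nz_u qform1_ge0.
pose c := (Num.sqrt (qform 1%:M u))^-1.
have c2 : c ^+ 2 = (qform 1%:M u)^-1 by rewrite exprVn sqr_sqrtr // ltW.
have /maxv : c *: u \in S.
  by apply/mem_set; rewrite /S /= qformZ c2 mulVf ?gt_eqF.
by rewrite qformZ c2 mulrC ler_pdivrMr.
Qed.

(** Let [mu] be the maximal Rayleigh quotient. Then [mu%:M - M] is positive semidefinite, so its
    form vanishes only on its kernel, which consists of eigenvectors for [mu]. Every eigenvalue is
    itself a Rayleigh quotient, hence at most [mu]. *)
Lemma largest_eigenvalueP M : (0 < n)%N -> M^T = M ->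
  [/\ exists2 v : 'rV_n, v != 0 & v *m M = largest_eigenvalue M *: v,
      forall u, qform M u <= largest_eigenvalue M * qform 1%:M u &
      forall u, qform M u = largest_eigenvalue M * qform 1%:M u ->
        u *m M = largest_eigenvalue M *: u].
Proof.
move=> n_gt0 symM; have [v nz_v maxv] := exists_max_qform M n_gt0.
have v_gt0 : 0 < qform 1%:M v by rewrite lt_def qform1_eq0 nz_v qform1_ge0.
pose mu := qform M v / qform 1%:M v.
have max_mu u : qform M u <= mu * qform 1%:M u.
  by rewrite /mu mulrAC ler_pdivlMr ?maxv.
have eig_mu u : qform M u = mu * qform 1%:M u -> u *m M = mu *: u.
  move=> defu; have symB : (mu%:M - M)^T = mu%:M - M.
    by rewrite linearB /= tr_scalar_mx symM.
  have := @psd_qform_eq0 _ u symB; rewrite mulmxBr mul_mx_scalar => uB.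
  apply/esym/subr0_eq/uB; last by rewrite qformBl qform_scalar -defu subrr.
  by move=> w; rewrite qformBl qform_scalar subr_ge0.
have vM : v *m M = mu *: v by apply: eig_mu; rewrite /mu divfK ?gt_eqF.
suff -> : largest_eigenvalue M = mu by split=> //; exists v.
apply: largest_eigenvalueE => [|b /eigenvalueP[u uM nz_u]].
  by apply/eigenvalueP; exists v.
have u_gt0 : 0 < qform 1%:M u by rewrite lt_def qform1_eq0 nz_u qform1_ge0.
rewrite -(ler_pM2r u_gt0); apply: le_trans _ (max_mu u).
by rewrite /qform uM mulmx1 -scalemxAl [leRHS]mxE.
Qed.

End QuadraticForm.

(** * The quadratic form of [alpha_mx] as a sum over edges, and Perron vectors *)

Section Energy.
Variables (R : realType) (alpha : R).

(** The contribution of an edge, with values [s] and [t] at its ends, to the quadratic form of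
    [alpha_mx]. *)
Definition edge_energy (s t : R) : R :=
  alpha * s ^+ 2 + alpha * t ^+ 2 + 2 * (1 - alpha) * s * t.

Lemma edge_energyC s t : edge_energy s t = edge_energy t s.
Proof. by rewrite /edge_energy; ring. Qed.

(** Ordered pairs are summed, so every edge counts twice; this is the source of the factors 2 in
    front of [rho]. Vectors are functions on the vertices, so that one vector can be tested on
    several relations over the same type. *)
Definition energy (V : finType) (e : rel V) (x : V -> R) : R :=
  \sum_a \sum_b (e a b)%:R * edge_energy (x a) (x b).

(** The action of [alpha_mx] on functions, with the degree term distributed over the neighbours. *)
Definition alpha_op (V : finType) (e : rel V) (x : V -> R) (a : V) : R :=
  \sum_b (e a b)%:R * (alpha * x a + (1 - alpha) * x b).

Lemma energy_alpha_op (V : finType) (e : rel V) (x : V -> R) : symmetric e ->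
  energy e x = 2 * \sum_a x a * alpha_op e x a.
Proof.
move=> symE; rewrite mulr_natl mulr2n /energy.
have defE : \sum_a x a * alpha_op e x a =
    \sum_a \sum_b (e a b)%:R * (alpha * x a ^+ 2 + (1 - alpha) * x a * x b).
  apply: eq_bigr => a _; rewrite mulr_sumr; apply: eq_bigr => b _; ring.
rewrite defE [X in _ = X + _]exchange_big /= -big_split; apply: eq_bigr => a _.
rewrite -big_split; apply: eq_bigr => b _ /=; rewrite symE /edge_energy; ring.
Qed.

Section Rho.
Variables (G : sgraph).
Hypothesis G_gt0 : (0 < #|G|)%N.
Local Notation A := (alpha_mx alpha G).
Local Notation e := (@adj G).
Let row_of (x : G -> R) : 'rV[R]_#|G| := \row_i x (enum_val i).

Let fun_of (v : 'rV[R]_#|G|) (a : G) : R := v 0 (enum_rank a).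

Let fun_ofK v : row_of (fun_of v) = v.
Proof. by apply/rowP => i; rewrite mxE /fun_of enum_valK. Qed.

Lemma alpha_mx_sym : A^T = A.
Proof.
apply/matrixP => i j; rewrite !mxE adj_sym eq_sym.
by case: eqP => [->|]; rewrite ?mulr0n.
Qed.

Let sum_row (F : G -> R) : \sum_(i < #|G|) F (enum_val i) = \sum_a F a.
Proof. by rewrite -(big_enum_val F); apply: eq_bigl. Qed.

Lemma row_of_alpha_mx x i : (row_of x *m A) 0 i = alpha_op e x (enum_val i).
Proof.
rewrite mxE /alpha_op.
have -> : \sum_b (e (enum_val i) b)%:R * (alpha * x (enum_val i) + (1 - alpha) * x b) =
    alpha * x (enum_val i) * (degree (enum_val i))%:R +
    \sum_b (1 - alpha) * (e (enum_val i) b)%:R * x b.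
  rewrite /degree -sum1_card natr_sum mulr_sumr.
  rewrite [X in _ = X + _](eq_bigl (fun b => e (enum_val i) b)); last first.
    by move=> b; rewrite inE.
  rewrite [X in _ = X + _]big_mkcond -big_split /=; apply: eq_bigr => b _.
  by case: (e _ b) => /=; ring.
rewrite -sum_row (bigD1 i) //= [X in _ = _ + X](bigD1 i) //= !mxE eqxx mulr1n.
rewrite adj_irrefl !mulr0 mul0r add0r addr0; congr (_ + _); first by ring.
apply: eq_bigr => j /negbTE ne_ji; rewrite !mxE ne_ji mulr0n adj_sym; ring.
Qed.

Lemma qform_alpha_mx x : qform A (row_of x) = energy e x / 2.
Proof.
rewrite energy_alpha_op; last exact: adj_sym.
rewrite mulrAC divff ?pnatr_eq0 // mul1r -sum_row /qform mxE.
by apply: eq_bigr => i _; rewrite row_of_alpha_mx !mxE mulrC.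
Qed.

Lemma energy_le_rho x : energy e x <= 2 * rho alpha G * \sum_a x a ^+ 2.
Proof.
have [_ /(_ (row_of x)) + _] := largest_eigenvalueP G_gt0 alpha_mx_sym.
rewrite qform_alpha_mx qform1 -/(rho _ _).
have -> : \sum_i row_of x 0 i ^+ 2 = \sum_a x a ^+ 2.
  by rewrite -sum_row; apply: eq_bigr => i _; rewrite mxE.
by rewrite ler_pdivrMr // mulrC mulrA.
Qed.

Lemma energy_eq_rho x : energy e x = 2 * rho alpha G * \sum_a x a ^+ 2 ->
  forall a, alpha_op e x a = rho alpha G * x a.
Proof.
move=> defx a.
have [_ _ /(_ (row_of x))] := largest_eigenvalueP G_gt0 alpha_mx_sym.
rewrite qform_alpha_mx qform1 -/(rho _ _) defx.
have -> : \sum_i row_of x 0 i ^+ 2 = \sum_a x a ^+ 2.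
  by rewrite -sum_row; apply: eq_bigr => i _; rewrite mxE.
move=> /(_ _)/rowP/(_ (enum_rank a)); rewrite row_of_alpha_mx !mxE enum_rankK.
by apply; field.
Qed.

(** Replacing an eigenvector for [rho] by its absolute values keeps the norm and does not lower the
    energy, so the result is again an eigenvector for [rho]. A zero of it would spread to all
    neighbours and, by connectedness, to the whole graph. *)
Lemma exists_Perron : alpha < 1 -> connected_graph G ->
  exists2 x : G -> R, (forall a, 0 < x a) &
    forall a, alpha_op e x a = rho alpha G * x a.
Proof.
move=> alpha_lt1 [_ connG].
have [[v nz_v vA] _ _] := largest_eigenvalueP G_gt0 alpha_mx_sym.
have beta_ge0 : 0 <= 1 - alpha by rewrite subr_ge0 ltW.
pose y := fun_of v.
have energy_y : energy e y = 2 * rho alpha G * \sum_a y a ^+ 2.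
  have : qform A v = rho alpha G * qform 1%:M v.
    by rewrite /qform vA mulmx1 -scalemxAl [LHS]mxE.
  rewrite -(fun_ofK v) qform_alpha_mx qform1.
  have -> : \sum_i row_of y 0 i ^+ 2 = \sum_a y a ^+ 2.
    by rewrite -sum_row; apply: eq_bigr => i _; rewrite mxE.
  by move=> defy; rewrite -mulrA -defy; field.
pose x a := `|y a|.
have sqx : \sum_a x a ^+ 2 = \sum_a y a ^+ 2.
  by apply: eq_bigr => a _; rewrite real_normK ?num_real.
have eigx : forall a, alpha_op e x a = rho alpha G * x a.
  apply: energy_eq_rho; apply: le_anti; rewrite energy_le_rho /= sqx -energy_y.
  apply: ler_sum => a _; apply: ler_sum => b _; apply: ler_wpM2l => //.
  rewrite /edge_energy /x !real_normK ?num_real // lerD2l -!mulrA -normrM.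
  rewrite ler_wpM2l // ler_wpM2l ?ler_norm //.
exists x => // a; rewrite lt_def normr_ge0 andbT; apply/eqP => xa0.
(* At a zero [b] the eigenvalue equation says that the nonnegative terms [(1 - alpha) * x c] over
   the neighbours [c] sum to 0. *)
have adj0 b c : e b c -> x b = 0 -> x c = 0.
  move=> ebc xb0; have := eigx b; rewrite /alpha_op xb0 [RHS]mulr0 => /eqP.
  rewrite psumr_eq0 => [/allP/(_ c (mem_index_enum c))|d _].
    by rewrite /= ebc mulr0 add0r mul1r mulf_eq0 subr_eq0 (gt_eqF alpha_lt1) => /eqP.
  by rewrite mulr0 add0r !mulr_ge0 ?normr_ge0.
have x0 b : x b = 0.
  have /connectP[p] := connG a b; elim: p a xa0 => [|c p IHp] a xa0 /=; first by move=> _ ->.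
  by case/andP=> eac; apply: IHp; apply: adj0 eac xa0.
case/eqP: nz_v; apply/rowP => i; rewrite mxE; apply/normr0_eq0.
by rewrite -[v](fun_ofK) mxE; apply: x0.
Qed.

Lemma eigenvalue_alpha_mx c : eigenvalue A c <->
  exists2 x : G -> R, exists b, x b != 0 & forall b, alpha_op e x b = c * x b.
Proof.
split=> [/eigenvalueP[v vA nz_v]|[x [b nz_xb] eigx]].
  exists (fun_of v) => [|b].
    apply/existsP; apply: contraNT nz_v => /existsPn v0.
    by apply/eqP/rowP => i; have /negbNE/eqP := v0 (enum_val i); rewrite /fun_of enum_valK mxE.
  rewrite -[b in LHS]enum_rankK -row_of_alpha_mx fun_ofK vA.
  by rewrite mxE.
apply/eigenvalueP; exists (row_of x).
  by apply/rowP => i; rewrite row_of_alpha_mx eigx !mxE.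
by apply: contra nz_xb => /eqP/rowP/(_ (enum_rank b)); rewrite !mxE enum_rankK => ->.
Qed.

End Rho.

Lemma rho_isomorphic (G H : sgraph) : isomorphic G H ->
  rho alpha G = rho alpha H.
Proof.
case=> f bij_f adj_f; have [h fK hK] := bij_f.
have op_f x a : alpha_op (@adj H) x (f a) = alpha_op (@adj G) (x \o f) a.
  rewrite /alpha_op (reindex f) /=; last exact: onW_bij.
  by apply: eq_bigr => b _; rewrite adj_f.
rewrite /rho /largest_eigenvalue; congr sup; apply/funext => c; apply/propext.
split=> /eigenvalue_alpha_mx[x [b nz_xb] eigx]; apply/eigenvalue_alpha_mx.
  exists (x \o h) => [|a]; first by exists (f b); rewrite /= fK.
  rewrite -[a]hK op_f /= fK -eigx; apply: eq_bigr => d _.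
  by rewrite /= !fK.
by exists (x \o f) => [|a]; [exists (h b); rewrite /= hK | rewrite -op_f eigx].
Qed.

End Energy.

(** * Rotating and reversing cycles; neighbours on paths and cycles *)

Section Cycles.
Variables (V : eqType) (e : rel V).
Hypothesis sym_e : symmetric e.

Lemma ucycle_rot_to (c : seq V) x : ucycle e c -> x \in c ->
  exists p, [/\ ucycle e (x :: p), size (x :: p) = size c & x :: p =i c].
Proof.
move=> ce xc; have [i p def_p] := rot_to xc; exists p; split.
- by rewrite -def_p /ucycle rot_cycle rot_uniq.
- by rewrite -def_p size_rot.
- by move=> y; rewrite -def_p mem_rot.
Qed.

Lemma ucycle_rev (x : V) p : ucycle e (x :: p) -> ucycle e (x :: rev p).
Proof.
rewrite /ucycle !cons_uniq rev_uniq mem_rev => /andP[ce ->]; rewrite andbT.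
rewrite -rotr1_rcons rotr_cycle -rev_cons rev_cycle.
by rewrite (eq_cycle (e' := e)) // => y z; rewrite sym_e.
Qed.

Lemma ucycle_swap a b p : ucycle e [:: b, a & p] -> ucycle e [:: a, b & rev p].
Proof.
move=> /ucycle_rev; rewrite rev_cons -rcons_cons -(rotr1_rcons a) /ucycle.
by rewrite rotr_cycle rotr_uniq.
Qed.

(** The two neighbours are the predecessor and the successor of [x]; they differ because the path is
    simple. *)
Lemma path_inner_nbrs h p x : path e h p -> uniq (h :: p) -> x \in p ->
  x != last h p ->
  exists y z, [/\ y != z, e x y, e x z, y \in h :: p & z \in h :: p].
Proof.
move=> + + xp; case/splitPr: xp => p1 [|z p2]; first by rewrite last_cat /= eqxx.
rewrite cat_path -cat_cons cat_uniq /= => /and4P[_ eyx exz _] /and3P[_ nhas _] _.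
exists (last h p1), z; rewrite sym_e -!cat_cons !mem_cat mem_last !inE !eqxx !orbT.
by split=> //; apply: contraNneq nhas => <-; rewrite mem_last orbT.
Qed.

Lemma ucycle_nbrs c x : ucycle e c -> (2 < size c)%N -> x \in c ->
  exists y z, [/\ y != z, e x y, e x z, y \in c & z \in c].
Proof.
move=> ce c_gt2 /(ucycle_rot_to ce)[[|h [|k p]] [cyc sz eqc]]; try by rewrite -sz in c_gt2.
move: cyc; rewrite /ucycle /= rcons_path => /andP[/and4P[exh _ _ elx] /and3P[_ hkp _]].
exists h, (last k p); split=> //; rewrite ?(sym_e x) // -?eqc ?inE ?eqxx ?orbT //.
  by apply: contraNneq hkp => ->; apply: mem_last.
by rewrite -in_cons mem_last !orbT.
Qed.

End Cycles.

(** * Moving edges from one end vertex to another *)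

Section MoveEdges.
Variables (V : finType) (e : rel V) (a b : V) (N : {set V}).
Hypotheses (sym_e : symmetric e) (irr_e : irreflexive e).

(** The edges from [b] to the vertices of [N] are replaced by edges from [a] to the same
    vertices. *)
Definition move_edges : rel V := fun x y =>
  [|| e x y && ~~ ((x == b) && (y \in N)) && ~~ ((y == b) && (x \in N)),
      (x == a) && (y \in N) | (y == a) && (x \in N)].

Hypothesis neq_ab : a != b.
Hypothesis NP : forall y, y \in N -> [/\ e b y, y != a & ~~ e a y].
Local Notation e' := move_edges.

Lemma move_edges_sym : symmetric e'.
Proof.
move=> x y; rewrite /e' sym_e -!andbA; congr (_ || _); last by rewrite orbC.
by congr (_ && _); rewrite andbC.
Qed.

Lemma move_edges_target : a \notin N.
Proof. by apply/negP => /NP[_ /eqP]. Qed.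

Lemma move_edges_source : b \notin N.
Proof. by apply/negP => /NP[]; rewrite irr_e. Qed.

Lemma move_edges_irr : irreflexive e'.
Proof.
move=> x; rewrite /e' irr_e orbb /=; apply/negP => /andP[/eqP ->].
exact/negP/move_edges_target.
Qed.

Lemma move_edges_new y : y \in N -> e' a y.
Proof. by move=> yN; rewrite /e' yN eqxx !orbT. Qed.

Lemma move_edges_away x y : x != a -> y != a -> e' x y -> e x y.
Proof. by rewrite /e' => /negbTE-> /negbTE->; rewrite !orbF => /andP[/andP[]]. Qed.

Lemma move_edges_targetE y : e' a y = e a y || (y \in N).
Proof.
rewrite /e' eqxx (negbTE neq_ab) (negbTE move_edges_target) !andbF !andbT /=.
by rewrite orbF.
Qed.

Lemma move_edges_sourceE y : e' b y = e b y && (y \notin N).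
Proof.
rewrite /e' eqxx [b == a]eq_sym (negbTE neq_ab) (negbTE move_edges_source).
by rewrite !andbF !orbF andbT.
Qed.

(** Every moved edge was present and no new edge is a loop or was present before, so the adjacency
    changes exactly by the indicators of these edges. The constant [F = 1] gives the edge count,
    [F = edge_energy] the change of the Rayleigh quotient. *)
Lemma sum_move_edges (R : comNzRingType) (F : V -> V -> R) :
  (forall x y, F x y = F y x) ->
  \sum_x \sum_y (e' x y)%:R * F x y =
  \sum_x \sum_y (e x y)%:R * F x y + 2 * \sum_(y in N) (F a y - F b y).
Proof.
move=> symF.
have natE x y : (e' x y)%:R = (e x y)%:R
    + (x == a)%:R * (y \in N)%:R - (x == b)%:R * (y \in N)%:R
    + ((y == a)%:R * (x \in N)%:R - (y == b)%:R * (x \in N)%:R) :> R.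
  rewrite /e'.
  have [xN|xN] := boolP (x \in N); have [yN|yN] := boolP (y \in N).
  - have [ebx /negbTE-> _] := NP xN; have [eby /negbTE-> _] := NP yN.
    have /negbTE-> : x != b by apply: contraNneq move_edges_source => <-.
    have /negbTE-> : y != b by apply: contraNneq move_edges_source => <-.
    by rewrite ?(andbF, andbT, orbF, orbT) /=; ring.
  - have [ebx /negbTE-> eax] := NP xN.
    have /negbTE-> : x != b by apply: contraNneq move_edges_source => <-.
    rewrite ?(andbF, andbT, orbF, orbT) /=; have [->|_] := eqVneq y a.
      by rewrite (negbTE neq_ab) ?orbT sym_e (negbTE eax) /=; ring.
    have [->|_] := eqVneq y b; first by rewrite sym_e ebx /=; ring.
    by rewrite ?(andbF, andbT, orbF, orbT) /=; ring.
  - have [eby /negbTE-> eay] := NP yN.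
    have /negbTE-> : y != b by apply: contraNneq move_edges_source => <-.
    rewrite ?(andbF, andbT, orbF, orbT) /=; have [->|_] := eqVneq x a.
      by rewrite (negbTE neq_ab) ?orbT (negbTE eay) /=; ring.
    have [->|_] := eqVneq x b; first by rewrite eby /=; ring.
    by rewrite ?(andbF, andbT, orbF, orbT) /=; ring.
  - by rewrite ?(andbF, andbT, orbF, orbT) /=; ring.
have sum1 c (H : V -> V -> R) : \sum_x \sum_y (x == c)%:R * (y \in N)%:R * H x y =
    \sum_(y in N) H c y.
  rewrite (bigD1 c) //= [X in _ + X]big1 ?addr0 => [|x /negbTE->]; last first.
    by rewrite big1 // => y _; rewrite !mul0r.
  rewrite [RHS]big_mkcond /=; apply: eq_bigr => y _.
  by rewrite eqxx mul1r; case: (y \in N); rewrite ?mul1r ?mul0r.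
have sum2 c (H : V -> V -> R) : \sum_x \sum_y (y == c)%:R * (x \in N)%:R * H x y =
    \sum_(x in N) H x c.
  by rewrite exchange_big /= (sum1 c (fun x y => H y x)).
have -> : \sum_x \sum_y (e' x y)%:R * F x y =
    \sum_x \sum_y (e x y)%:R * F x y
    + (\sum_x \sum_y (x == a)%:R * (y \in N)%:R * F x y
       - \sum_x \sum_y (x == b)%:R * (y \in N)%:R * F x y)
    + (\sum_x \sum_y (y == a)%:R * (x \in N)%:R * F x y
       - \sum_x \sum_y (y == b)%:R * (x \in N)%:R * F x y).
  rewrite -!sumrB -!big_split /=; apply: eq_bigr => x _.
  rewrite -!sumrB -!big_split /=; apply: eq_bigr => y _.
  by rewrite natE; ring.
rewrite !sum1 !sum2 -!sumrB mulr_natl mulr2n addrA; congr (_ + _).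
by apply: eq_bigr => y _; rewrite (symF y a) (symF y b).
Qed.

(** A lost edge from [b] to [w] is replaced by a walk from [b] to [a] followed by the new edge from
    [a] to [w]. *)
Lemma move_edges_connect : (forall x y, connect e x y) -> connect e' b a ->
  forall x y, connect e' x y.
Proof.
move=> conn_e e'ba x y; have csym := sym_connect_sym move_edges_sym.
apply: (connect_sub _ (conn_e x y)) => {x y} x y exy.
have move1 z w : z == b -> w \in N -> connect e' z w.
  move=> /eqP-> wN; apply: connect_trans e'ba (connect1 _).
  exact: move_edges_new.
have [/andP[xb yN]|n1] := boolP ((x == b) && (y \in N)); first exact: move1.
have [/andP[yb xN]|n2] := boolP ((y == b) && (x \in N)).
  by rewrite csym; apply: move1.
by apply: connect1; rewrite /move_edges exy n1 n2.
Qed.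

End MoveEdges.

(** * Candidates, and the moves that preserve them *)

Section Candidates.
Local Open Scope nat_scope.
Variables (V : finType) (g : nat).
Hypothesis g_ge3 : 2 < g.

(** Girth exactly [g] is not demanded, so that for a move only short cycles have to be excluded. *)
Definition girth_ge (e : rel V) : Prop :=
  forall c, 2 < size c -> ucycle e c -> g <= size c.

(** Ordered adjacent pairs are counted, so [2 * #|V| + 2] means one edge more than vertices. *)
Record candidate (e : rel V) : Prop := Candidate {
  candidate_sym : symmetric e;
  candidate_irr : irreflexive e;
  candidate_conn : forall x y, connect e x y;
  candidate_arcs : \sum_x \sum_y (e x y : nat) = 2 * #|V| + 2;
  candidate_girth : girth_ge e }.

Variable e : rel V.
Hypothesis cand_e : candidate e.
Let sym_e := candidate_sym cand_e.
Let irr_e := candidate_irr cand_e.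

Section Move.
Variables (a b : V) (N : {set V}).
Hypothesis neq_ab : a != b.
Hypothesis NP : forall y, y \in N -> [/\ e b y, y != a & ~~ e a y].
Local Notation e' := (move_edges e a b N).

(** A cycle of the new graph that uses no new edge is an old one. If both its edges at [a] are new,
    then [b] can take the place of [a], provided that the cycle avoids [b]: this is the first
    assumption. If only one of them is new, the second assumption bounds the length. *)
Lemma move_edges_girth :
  (forall h p, path e' h p -> uniq (h :: p) -> a \notin h :: p -> h \in N ->
     0 < size p -> last h p \in N -> b \notin h :: p) ->
  (forall h p, path e' h p -> path e h p -> uniq (h :: p) -> a \notin h :: p ->
     h \in N -> 0 < size p -> e a (last h p) -> last h p \notin N ->
     g <= (size p).+2) ->
  girth_ge e'.
Proof.
move=> avoid_b mixed c c_gt2 ce'.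
have away p h : a \notin h :: p -> path e' h p -> path e h p.
  move=> anp; apply: (sub_in_path (P := predC1 a)) => [x y xa ya|].
    exact: move_edges_away.
  by apply/allP => x xp; apply: contraNneq anp => <-.
have new h p : ucycle e' (a :: h :: p) -> 0 < size p -> h \in N -> g <= (size p).+2.
  rewrite /ucycle /= rcons_path => /andP[/and3P[_ hp la] /andP[anp /andP[hnp up]]] p_gt0 hN.
  have ep := away _ _ anp hp.
  have uhp : uniq (h :: p) by rewrite /= hnp.
  have [lN|lN] := boolP (last h p \in N); last first.
    apply: (mixed h p) => //.
    by move: la; rewrite move_edges_sym // move_edges_targetE // (negbTE lN) orbF.
  apply: (candidate_girth cand_e (c := b :: h :: p)) => //.
  rewrite /ucycle cons_uniq avoid_b // uhp !andbT /= rcons_path ep (sym_e _ b).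
  by have [-> _ _] := NP hN; have [] := NP lN.
have [ac|anc] := boolP (a \in c); last first.
  apply: (candidate_girth cand_e c_gt2).
  case/andP: ce' => ce' uc; rewrite /ucycle uc andbT.
  apply: (sub_in_cycle (P := predC1 a)) ce' => [x y xa ya|].
    exact: move_edges_away.
  by apply/allP => x xp; apply: contraNneq anc => <-.
have [[|h p] [cyc sz _]] := ucycle_rot_to ce' ac; first by rewrite -sz in c_gt2.
rewrite -sz in c_gt2 *; have p_gt0 : 0 < size p := c_gt2.
have [hN|hN] := boolP (h \in N); first exact: (new h p cyc p_gt0 hN).
(* Reversing the cycle lets its other edge at [a] come first. *)
have : ucycle e' [:: a, last h p & rev (belast h p)].
  by rewrite -rev_rcons -lastI; apply: ucycle_rev cyc; apply: move_edges_sym.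
have [lN|lN] := boolP (last h p \in N).
  by move=> /new; rewrite size_rev size_belast; apply.
move=> _; apply: (candidate_girth cand_e) => //.
move: cyc; rewrite /ucycle /= !rcons_path => /andP[/and3P[]].
rewrite move_edges_targetE // (negbTE hN) orbF => -> hp.
rewrite move_edges_sym // move_edges_targetE // (negbTE lN) orbF sym_e => ->.
by case/andP=> anp ->; rewrite anp (away _ _ anp hp).
Qed.

Lemma move_edges_candidate : connect e' b a -> girth_ge e' -> candidate e'.
Proof.
move=> conn_ba girth_e'; split=> //.
- exact: move_edges_sym.
- exact: move_edges_irr.
- exact: move_edges_connect (candidate_conn cand_e) conn_ba.
(* The number of arcs is the case of the constant 1 in [sum_move_edges]; as that lemma needs
   subtraction, the count is cast to [int]. *)
have arcsE (f : rel V) :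
    ((\sum_x \sum_y (f x y : nat))%:R = \sum_x \sum_y (f x y)%:R * 1 :> int)%R.
  rewrite natr_sum; apply: eq_bigr => x _; rewrite natr_sum.
  by apply: eq_bigr => y _; rewrite mulr1.
rewrite -(candidate_arcs cand_e); apply/eqP.
rewrite -(eqr_nat int) !arcsE (sum_move_edges sym_e irr_e neq_ab NP (F := fun _ _ => 1%R)) //.
by rewrite [X in (_ + 2 * X)%R]big1 ?mulr0 ?addr0 // => y _; rewrite subrr.
Qed.

End Move.

(** A common neighbour of [a] and [b] would give a triangle through [ab], but cycles through [ab]
    are longer than [g >= 3]. *)
Lemma contract_movable a b : e a b ->
  (forall p, ucycle e [:: a, b & p] -> 0 < size p -> g < (size p).+2) ->
  forall y, y \in [set y | e b y & y != a] -> [/\ e b y, y != a & ~~ e a y].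
Proof.
move=> eab long_ab y; rewrite inE => /andP[eby neq_ya]; split=> //; apply/negP => eay.
have neq_ab : a != b by apply: contraTneq eab => ->; rewrite irr_e.
have := long_ab [:: y]; rewrite /ucycle /= eab eby sym_e eay !inE eq_sym in neq_ya *.
have neq_by : b != y by apply: contraTneq eby => ->; rewrite irr_e.
rewrite (negbTE neq_ab) (negbTE neq_ya) (negbTE neq_by) => /(_ isT isT).
by rewrite !ltnS leqNgt g_ge3.
Qed.

(* The move contracts the edge [ab] and attaches [b] as a leaf at [a]. *)
Lemma contract_candidate a b : e a b ->
  (forall p, ucycle e [:: a, b & p] -> 0 < size p -> g < (size p).+2) ->
  candidate (move_edges e a b [set y | e b y & y != a]).
Proof.
move=> eab long_ab; set N := [set y | _ & _].
have neq_ab : a != b by apply: contraTneq eab => ->; rewrite irr_e.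
have NP := contract_movable eab long_ab; rewrite -/N in NP.
have b_nbr y : move_edges e a b N b y -> y = a.
  rewrite move_edges_sourceE // !inE => /andP[->] /=.
  by rewrite negbK => /eqP.
have avoid_b h p : path (move_edges e a b N) h p -> a \notin h :: p -> h \in N ->
    b \notin h :: p.
  move=> hp anp hN; rewrite inE negb_or (contraNneq _ (move_edges_source irr_e NP)) => [|->//].
  apply/negP => bp; case/splitPr: bp hp anp => p1 p2.
  rewrite cat_path /= -cat_cons mem_cat negb_or => /and3P[_ + _] /andP[+ _].
  by rewrite move_edges_sym // => /b_nbr <-; rewrite mem_last.
apply: move_edges_candidate => //.
  apply: connect1; rewrite move_edges_sourceE // sym_e eab.
  by rewrite (move_edges_target (e := e) (b := b)).
apply: move_edges_girth => // [h p hp _ anp hN _ _|h p hp ep uhp anp hN p_gt0 eal lN].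
  exact: avoid_b.
(* Inserting [b] between [a] and [h] gives an old cycle through [ab], longer by one; its length
   exceeds [g]. *)
have := long_ab (h :: p); rewrite /ucycle /= !rcons_path eab ep (sym_e _ a) eal.
rewrite inE negb_or neq_ab anp (avoid_b h p) // -[_ && uniq p]/(uniq (h :: p)) uhp.
by have [-> _ _] := NP h hN; move=> /(_ isT isT).
Qed.

Lemma fold_nonadjacent a v b : e v a -> e v b -> a != b ->
  (forall p, ucycle e [:: v, a & p] -> last a p = b -> g.+1 < (size p).+2) ->
  e a b = false.
Proof.
move=> eva evb neq_ab long_avb; have ebv : e b v by rewrite sym_e.
have neq_va : v != a by apply: contraTneq eva => ->; rewrite irr_e.
have neq_vb : v != b by apply: contraTneq evb => ->; rewrite irr_e.
apply/negP => eab; have cyc : ucycle e [:: v; a; b].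
  by rewrite /ucycle /= eva eab ebv !inE negb_or neq_va neq_vb neq_ab.
by have := ltnW (long_avb [:: b] cyc erefl); rewrite !ltnS leqNgt g_ge3.
Qed.

(** A common neighbour of [a] and [b] other than [v] would close a 4-cycle through [a], [v], [b],
    but such cycles are longer than [g + 1 >= 4]. *)
Lemma fold_movable a v b : e v a -> e v b -> a != b ->
  (forall p, ucycle e [:: v, a & p] -> last a p = b -> g.+1 < (size p).+2) ->
  forall y, y \in [set y | e b y & y != v] -> [/\ e b y, y != a & ~~ e a y].
Proof.
move=> eva evb neq_ab long_avb y; have ebv : e b v by rewrite sym_e.
have neq_va : v != a by apply: contraTneq eva => ->; rewrite irr_e.
have neq_vb : v != b by apply: contraTneq evb => ->; rewrite irr_e.
have eabF := fold_nonadjacent eva evb neq_ab long_avb.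
rewrite inE => /andP[eby neq_yv]; split=> //.
  by apply: contraTneq eby => ->; rewrite sym_e eabF.
apply/negP => eay; have eyb : e y b by rewrite sym_e.
have neq_ay : a != y by apply: contraTneq eay => ->; rewrite irr_e.
have neq_yb : y != b by apply: contraTneq eby => ->; rewrite irr_e.
have cyc : ucycle e [:: v; a; y; b].
  rewrite /ucycle /= eva eay eyb ebv !inE !negb_or neq_va (eq_sym v y) neq_yv.
  by rewrite neq_vb neq_ay neq_ab neq_yb.
by have := long_avb [:: y; b] cyc erefl; rewrite !ltnS leqNgt g_ge3.
Qed.

(* The move identifies the neighbours [a] and [b] of [v] and attaches [b] as a leaf
   at [v]. *)
Lemma fold_candidate a v b : e v a -> e v b -> a != b ->
  (forall p, ucycle e [:: v, a & p] -> last a p = b -> g.+1 < (size p).+2) ->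
  candidate (move_edges e a b [set y | e b y & y != v]).
Proof.
move=> eva evb neq_ab long_avb; set N := [set y | _ & _].
have eav : e a v by rewrite sym_e.
have ebv : e b v by rewrite sym_e.
have neq_va : v != a by apply: contraTneq eva => ->; rewrite irr_e.
have neq_vb : v != b by apply: contraTneq evb => ->; rewrite irr_e.
have eabF := fold_nonadjacent eva evb neq_ab long_avb.
have NP := fold_movable eva evb neq_ab long_avb; rewrite -/N in NP.
have b_nbr y : move_edges e a b N b y -> y = v.
  rewrite move_edges_sourceE // !inE => /andP[->] /=.
  by rewrite negbK => /eqP.
have avoid_b h p : path (move_edges e a b N) h p -> uniq (h :: p) -> h \in N ->
    last h p != b -> b \notin h :: p.
  move=> hp uhp hN lb; rewrite inE negb_or (contraNneq _ (move_edges_source irr_e NP)) => [|->//].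
  apply/negP => bp; rewrite eq_sym in lb.
  have [y [z [neq_yz /b_nbr defy /b_nbr defz _ _]]] :=
    path_inner_nbrs (move_edges_sym a b N sym_e) hp uhp bp lb.
  by rewrite defy defz eqxx in neq_yz.
apply: move_edges_candidate => //.
  apply: (@connect_trans _ _ v); apply: connect1.
    by rewrite move_edges_sourceE // ebv inE eqxx andbF.
  by rewrite move_edges_sym // move_edges_targetE // eav.
apply: move_edges_girth => // [h p hp uhp anp hN _ lN|h p hp ep uhp anp hN p_gt0 eal lN].
  by apply: avoid_b => //; apply: contraNneq (move_edges_source irr_e NP) => <-.
have bnp : b \notin h :: p.
  by apply: avoid_b => //; apply: contraTneq eal => ->; rewrite eabF.
have [ebh _ _] := NP h hN.
(* If the new cycle avoids [v], then inserting [v] and [b] between [a] and [h] gives an old cycle,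
   longer by two, of length at least [g + 2]. *)
have [vp|vnp] := boolP (v \in h :: p); last first.
  have uniq_q q : uniq q -> a \notin q -> b \notin q -> v \notin q ->
      uniq (v :: b :: rcons q a).
    move=> uq aq bq vq; rewrite /= rcons_uniq !inE !mem_rcons !inE !negb_or.
    by rewrite uq aq bq vq neq_va neq_vb (eq_sym b) neq_ab.
  have : ucycle e (v :: b :: rcons (h :: p) a).
    rewrite /ucycle uniq_q // andbT /= !rcons_path last_rcons evb ebh ep.
    by rewrite (sym_e _ a) eal eav.
  move=> /(ucycle_rev sym_e).
  rewrite rev_cons rev_rcons => /long_avb; rewrite last_rcons => /(_ erefl).
  by rewrite size_rcons size_rev !ltnS.
have vp' : v \in p.
  by move: vp; rewrite inE => /orP[/eqP defv|//]; move: hN; rewrite -defv inE eqxx andbF.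
(* Otherwise the part of the cycle from [h] to [v], closed up through [b], is an old cycle that is
   no longer. *)
case/splitPr: vp' ep uhp bnp => p1 p2; rewrite cat_path -cat_cons => /and3P[ep1 e1v _].
rewrite cat_uniq => /and3P[u1 nhas _]; rewrite mem_cat negb_or => /andP[bn1 _].
have := candidate_girth cand_e (c := b :: rcons (h :: p1) v).
rewrite /= size_rcons size_cat /= => /(_ isT) girth; apply: leq_trans (girth _) _;
  last by rewrite !ltnS addnS ltnS leq_addr.
have vn1 : v \notin h :: p1 by apply: contra nhas => v1; rewrite /= v1.
rewrite /ucycle cons_uniq -rcons_cons mem_rcons rcons_uniq in_cons negb_or eq_sym neq_vb bn1 u1 vn1.
by rewrite !andbT /= !rcons_path last_rcons ebh ep1 e1v evb.
Qed.

(** A leaf lies on no cycle, before or after the move, so no short cycle can arise. *)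
Lemma move_leaves_candidate a b (N : {set V}) : a != b -> a \notin N ->
  (forall y z, y \in N -> e y z = (z == b)) ->
  candidate (move_edges e a b N).
Proof.
move=> neq_ab aN leafN.
have NP y : y \in N -> [/\ e b y, y != a & ~~ e a y].
  move=> yN; rewrite sym_e leafN // eqxx sym_e leafN // neq_ab; split=> //.
  by apply: contraNneq aN => <-.
have dead_end h p : path (move_edges e a b N) h p -> a \notin h :: p -> h \in N ->
    0 < size p -> False.
  case: p => [//|y p] /= /andP[e'hy _] anp hN _.
  have : y = b.
    apply/eqP; rewrite -(leafN h) //; apply: move_edges_away e'hy.
      by apply: contraNneq anp => ->; rewrite inE eqxx.
    by apply: contraNneq anp => ->; rewrite !inE eqxx orbT.
  move=> defy; move: e'hy; rewrite defy move_edges_sym // move_edges_sourceE // hN.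
  by rewrite andbF.
apply: move_edges_candidate => //; last first.
  by apply: move_edges_girth => // h p hp *; exfalso; apply: (dead_end h p).
have bN := move_edges_source irr_e NP.
(* Collapsing the moved leaves to [b] turns old walks into walks that use no moved edge. *)
pose f x := if x \in N then b else x.
have f_connect x y : connect e x y -> connect (move_edges e a b N) (f x) (f y).
  case/connectP=> p + ->; elim: p x => [|z p IHp] x //= /andP[exz /IHp].
  apply: connect_trans; rewrite /f; case: ifP => xN; case: ifP => zN //.
  - by move: exz; rewrite leafN // => /eqP->.
  - by move: exz; rewrite sym_e leafN // => /eqP->.
  by apply: connect1; rewrite /move_edges exz xN zN !andbF.
have := f_connect b a (candidate_conn cand_e b a).
by rewrite /f (negbTE bN) (negbTE aN).
Qed.

End Candidates.

(** * The edges of a walk *)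

Section Steps.
Variable T : eqType.
Implicit Types (u v : T) (p P : seq T).

Definition steps u p : seq (T * T) := zip (u :: p) p.

Definition linked u p : rel T :=
  fun a b => ((a, b) \in steps u p) || ((b, a) \in steps u p).

Lemma steps_cat u p1 p2 : steps u (p1 ++ p2) = steps u p1 ++ steps (last u p1) p2.
Proof. by elim: p1 u => //= a p1 IHp u; rewrite /steps /= -/(steps _ _) IHp. Qed.

Lemma steps_rcons u p v : steps u (rcons p v) = rcons (steps u p) (last u p, v).
Proof. by rewrite -!cats1 steps_cat. Qed.

Lemma steps_nth d u p a b : (a, b) \in steps u p ->
  exists2 k, (k < size p)%N & a = nth d (u :: p) k /\ b = nth d p k.
Proof.
elim: p u => // c p IHp u; rewrite /steps /= -/(steps _ _) inE => /orP[/eqP[-> ->]|/IHp].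
  by exists 0%N.
by case=> k lt_k [-> ->]; exists k.+1.
Qed.

Lemma steps_rev u P v :
  steps v (rcons (rev P) u) = rev [seq (ab.2, ab.1) | ab <- steps u (rcons P v)].
Proof.
elim: P u => //= a P IHP u; rewrite rev_cons steps_rcons last_rcons IHP.
by rewrite /steps /= rev_cons.
Qed.

Lemma linked_rev u P v a b :
  linked v (rcons (rev P) u) a b = linked u (rcons P v) a b.
Proof.
have mem_swap (l : seq (T * T)) : ((a, b) \in [seq (cd.2, cd.1) | cd <- l]) = ((b, a) \in l)
    /\ ((b, a) \in [seq (cd.2, cd.1) | cd <- l]) = ((a, b) \in l).
  by split; elim: l => //= -[c d] l IHl; rewrite !inE IHl !xpair_eqE andbC.
rewrite /linked steps_rev !mem_rev; have [-> ->] := mem_swap (steps u (rcons P v)).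
exact: orbC.
Qed.

Lemma path_rev_rcons (e : rel T) u P v : symmetric e ->
  path e u (rcons P v) = path e v (rcons (rev P) u).
Proof.
move=> sym_e; rewrite -[RHS]rev_path last_rcons belast_rcons rev_cons revK.
by apply: eq_path => a b; rewrite sym_e.
Qed.

End Steps.

(** * Leaves, and the graph induced on the non-leaves *)

Section Structure.
Local Open Scope nat_scope.
Variables (V : finType) (e : rel V).

Definition branching : {set V} := [set a | 1 < #|[set b | e a b]|].
Local Notation K := branching.

Definition core_nbrs a : {set V} := [set b in K | e a b].

(* The graph is made of the paths [u, P1, v], [u, P2, v] and [u, P3, v], with pendant
   vertices attached. *)
Record theta_core u v P1 P2 P3 : Prop := ThetaCore {
  theta_core_path1 : path e u (rcons P1 v);
  theta_core_path2 : path e u (rcons P2 v);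
  theta_core_path3 : path e u (rcons P3 v);
  theta_core_uniq : uniq (u :: v :: P1 ++ P2 ++ P3);
  theta_core_mem : K =i u :: v :: P1 ++ P2 ++ P3;
  theta_core_inner : forall P l a m, P \in [:: P1; P2; P3] -> P = l ++ a :: m ->
    core_nbrs a = [set last u l; head v m];
  theta_core_linked : forall a b, a \in K -> b \in K -> e a b ->
    [|| linked u (rcons P1 v) a b, linked u (rcons P2 v) a b
      | linked u (rcons P3 v) a b];
  theta_core_leaf : forall a, a \notin K -> exists2 b, b \in K & forall c, e a c = (c == b) }.

(** The two ends and the three paths play symmetric roles; this lemma and the next two allow any end
    to be put first and any path to be singled out. *)
Lemma theta_core_rev u v P1 P2 P3 : symmetric e ->
  theta_core u v P1 P2 P3 -> theta_core v u (rev P1) (rev P2) (rev P3).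
Proof.
move=> sym_e [p1 p2 p3 un mem_K inner lnk leaf].
have permE : perm_eq (v :: u :: rev P1 ++ rev P2 ++ rev P3) (u :: v :: P1 ++ P2 ++ P3).
  by apply/permP => q; rewrite /= !count_cat !count_rev addnCA.
split=> //; rewrite -?path_rev_rcons //.
- by rewrite (perm_uniq permE).
- by move=> a; rewrite mem_K (perm_mem permE).
- move=> P l a m PP defP; have last_rev (c : V) t : last c (rev t) = head c t.
    by case: t => //= d t; rewrite rev_cons last_rcons.
  rewrite (inner (rev P) (rev m) a (rev l)).
  + by rewrite last_rev -[l in last v l]revK last_rev setUC.
  + by move: PP; rewrite !inE -!(inj_eq (can_inj revK) P) !revK.
  by rewrite defP rev_cat rev_cons cat_rcons.
- by move=> a b aK bK eab; rewrite !linked_rev; apply: lnk.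
Qed.

Lemma theta_core_swap12 u v P1 P2 P3 :
  theta_core u v P1 P2 P3 -> theta_core u v P2 P1 P3.
Proof.
move=> [p1 p2 p3 un mem_K inner lnk leaf].
have permE : perm_eq (u :: v :: P2 ++ P1 ++ P3) (u :: v :: P1 ++ P2 ++ P3).
  by rewrite !perm_cons perm_catCA.
split=> //.
- by rewrite (perm_uniq permE).
- by move=> a; rewrite mem_K (perm_mem permE).
- by move=> P l a m PP; apply: inner; move: PP; rewrite !inE orbCA.
by move=> a b aK bK eab; rewrite orbCA; apply: lnk.
Qed.

Lemma theta_core_swap13 u v P1 P2 P3 :
  theta_core u v P1 P2 P3 -> theta_core u v P3 P2 P1.
Proof.
move=> [p1 p2 p3 un mem_K inner lnk leaf].
have permE : perm_eq (u :: v :: P3 ++ P2 ++ P1) (u :: v :: P1 ++ P2 ++ P3).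
  by apply/permP => q; rewrite /= !count_cat; clear; lia.
split=> //.
- by rewrite (perm_uniq permE).
- by move=> a; rewrite mem_K (perm_mem permE).
- by move=> P l a m PP; apply: inner; move: PP; rewrite !inE => /or3P[]->; rewrite ?orbT.
by move=> a b aK bK /(lnk a b aK bK) /or3P[] ->; rewrite ?orbT.
Qed.

Lemma branchingP a : reflect (exists b c, [/\ b != c, e a b & e a c]) (a \in K).
Proof.
rewrite inE; apply: (iffP card_gt1P) => -[b [c]].
  by rewrite !inE => -[eab eac neq_bc]; exists b, c.
by case=> neq_bc eab eac; exists b, c; rewrite !inE.
Qed.

Variable g : nat.
Hypothesis g_ge3 : 2 < g.
Hypothesis cand_e : candidate g e.
Let sym_e := candidate_sym cand_e.
Let irr_e := candidate_irr cand_e.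

Lemma connected_closed (W : {pred V}) a : a \in W ->
  (forall b c, b \in W -> e b c -> c \in W) -> forall b, b \in W.
Proof.
move=> aW closedW b; have /connectP[p + ->] := candidate_conn cand_e a b.
by elim: p a aW => //= c p IHp a aW /andP[/(closedW a c aW)]; apply: IHp.
Qed.

Lemma degreeE a : #|[set b | e a b]| = \sum_b e a b.
Proof. by rewrite -sum1dep_card big_mkcond; apply: eq_bigr => b _; case: (e a b). Qed.

(** An isolated vertex would be the whole graph, which would then have no edge. *)
Lemma leaf_degree a : a \notin K -> #|[set b | e a b]| = 1.
Proof.
rewrite inE -leqNgt => deg_le1; apply/eqP; rewrite eqn_leq deg_le1 lt0n /=.
apply/eqP => /cards0_eq deg0.
have only_a : forall b, b \in pred1 a.
  apply: (@connected_closed _ a) => [|b c]; rewrite ?inE // => /eqP-> eac.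
  by have /setP/(_ c) := deg0; rewrite !inE eac.
have := candidate_arcs cand_e; rewrite big1 => [|b _]; first by rewrite addn2.
by rewrite big1 // => c _; rewrite (eqP (only_a b)) (eqP (only_a c)) irr_e.
Qed.

Lemma leaf_nbr a : a \notin K -> exists b, forall c, e a c = (c == b).
Proof.
move=> /leaf_degree/eqP/cards1P[b defb]; exists b => c.
by have /setP/(_ c) := defb; rewrite !inE.
Qed.

(** Two adjacent leaves would form a whole component, hence the graph; all degrees would be 1,
    contrary to the edge count. *)
Lemma leaf_nbr_branching a b : a \notin K -> e a b -> b \in K.
Proof.
move=> aK eab; apply/negPn/negP => bK.
have no_branching c : c \notin K.
  have: c \in pred2 a b.
    apply: (@connected_closed _ a) => [|{}c d]; rewrite !inE ?eqxx // => /orP[]/eqP->.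
      have [b' leafE] := leaf_nbr aK; move: eab; rewrite !leafE => /eqP<- /eqP->.
      by rewrite eqxx orbT.
    have [a' leafE] := leaf_nbr bK; move: eab; rewrite sym_e !leafE => /eqP<- /eqP->.
    by rewrite eqxx.
  by move=> /orP[]/eqP->.
have := candidate_arcs cand_e.
rewrite (eq_bigr (fun=> 1)) => [|c _].
  rewrite sum1_card => /eqP.
  by rewrite ltn_eqF // mul2n -addnn -addnA -addn1 leq_add2l addn2.
by rewrite -degreeE leaf_degree.
Qed.

(** Deleting a leaf removes one vertex and one edge, so the excess of edges over vertices survives
    in the core. *)
Lemma sum_core_nbrs : \sum_(a in K) #|core_nbrs a| = 2 * #|K| + 2.
Proof.
have cardE a (B : {set V}) : #|[set b in B | e a b]| = \sum_(b in B) e a b.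
  by rewrite -sum1dep_card big_mkcondr; apply: eq_bigr => b _; case: (e a b).
rewrite (eq_bigr _ (fun a _ => cardE a K)).
have degC b : b \notin K -> \sum_(a in K) (e a b : nat) = 1.
  move=> bK; rewrite -(leaf_degree bK) degreeE.
  rewrite [RHS](bigID (mem K)) /= [X in _ = _ + X]big1 ?addn0 => [|a aK].
    by apply: eq_bigr => a _; rewrite sym_e.
  by case: (boolP (e b a)) => // /(leaf_nbr_branching bK); rewrite (negbTE aK).
have := candidate_arcs cand_e.
rewrite (bigID (mem K)) /= [X in _ + X](eq_bigr (fun=> 1)) => [|a aK]; last first.
  by rewrite -degreeE leaf_degree.
under eq_bigr => a do rewrite (bigID (mem K)) /=.
rewrite big_split /= [X in _ + X + _]exchange_big /=.
rewrite [X in _ + X + _](eq_bigr (fun=> 1)) => [|b bK]; last exact: degC.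
have <- : #|K| + #|[predC K]| = #|V| := cardC (mem K).
rewrite sum1_card.
rewrite (eq_card (B := [predC K])) // => sumE; apply/eqP.
rewrite -(eqn_add2r (#|[predC K]| + #|[predC K]|)) addnA sumE.
by move: #|K| #|[predC K]| => k l; apply/eqP; clear; lia.
Qed.

(** These two cycle conditions are what maximality of [rho] provides; the classification that they
    entail is purely combinatorial. *)
Hypothesis edge_on_cycle : forall a b, e a b -> a \in K -> b \in K ->
  exists2 p, ucycle e [:: a, b & p] & (size p).+2 = g.
Hypothesis cherry_on_cycle : forall a b c, e a b -> e a c -> b \in K -> c \in K ->
  b != c -> exists p, [/\ ucycle e [:: a, b & p], last b p = c & (size p).+2 <= g.+1].

Lemma mem_core_nbrs a b : b \in core_nbrs a = (b \in K) && e a b.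
Proof. by rewrite inE. Qed.

Lemma ucycle_branching c a : ucycle e c -> 2 < size c -> a \in c -> a \in K.
Proof.
move=> cyc c_gt2 /(ucycle_nbrs sym_e cyc c_gt2)[b [d [neq_bd eab ead _ _]]].
by apply/branchingP; exists b, d.
Qed.

(** Without a core neighbour, [a] would be the whole core and the degree sum would be 0 instead of
    4. With one, the edge to it lies on a cycle, which supplies a second neighbour. *)
Lemma core_nbrs_ge2 a : a \in K -> 1 < #|core_nbrs a|.
Proof.
move=> aK; have [b] : exists b, b \in core_nbrs a.
  apply/set0Pn/negP => /eqP nbrs0.
  have nbrsF b : e a b -> b \notin K.
    by move=> eab; apply/negP => bK; have /setP/(_ b) := nbrs0; rewrite in_set in_set0 bK eab.
  have K1 : K = [set a].
    have W b : (b == a) || e a b.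
      move: b; apply: (@connected_closed (fun b => (b == a) || e a b) a).
        by rewrite unfold_in eqxx.
      move=> b c; rewrite !unfold_in => /orP[/eqP->|eab] ebc; first by rewrite ebc orbT.
      have [d leafE] := leaf_nbr (nbrsF b eab).
      by move: eab ebc; rewrite sym_e !leafE => /eqP<- /eqP->; rewrite eqxx.
    apply/setP => b; rewrite [RHS]in_set1; have /orP[/eqP->|eab] := W b.
      by rewrite eqxx.
    by rewrite (negbTE (nbrsF b eab)); apply/esym/negP => /eqP defb; rewrite defb irr_e in eab.
  have := sum_core_nbrs; rewrite K1 big_set1 nbrs0 cards0 cards1.
  by [].
rewrite mem_core_nbrs => /andP[bK eab].
have [p cyc sz] := edge_on_cycle eab aK bK.
have p_gt0 : 0 < size p by rewrite -2!ltnS sz.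
have c_gt2 : 2 < size [:: a, b & p] by rewrite /= !ltnS.
have last_c : last b p \in [:: a, b & p] by rewrite in_cons mem_last orbT.
apply/card_gt1P; exists b, (last b p); rewrite !mem_core_nbrs bK eab.
rewrite (ucycle_branching cyc c_gt2 last_c) sym_e; split=> //.
  by move: cyc; rewrite /ucycle /= rcons_path => /andP[/and3P[]].
case/andP: cyc => _ /=; case/lastP: p p_gt0 {sz c_gt2 last_c} => // p c _.
by rewrite last_rcons mem_rcons !inE !negb_or => /and3P[_ /andP[]].
Qed.

Lemma exists_hub : exists2 u, u \in K & 2 < #|core_nbrs u|.
Proof.
have [/existsP[u /andP[]]|/existsPn le2] := boolP [exists u, (u \in K) && (2 < #|core_nbrs u|)].
  by exists u.
have: \sum_(a in K) #|core_nbrs a| <= \sum_(a in K) 2.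
  by apply: leq_sum => a aK; move: (le2 a); rewrite aK -leqNgt.
by rewrite sum_core_nbrs sum_nat_const mulnC addn2 ltnNge ltnW.
Qed.

(** Core degrees are at least 2 and exceed 2 by 2 in total, so two vertices of larger degree use up
    the excess. *)
Lemma two_hubs u v : u != v -> u \in K -> v \in K ->
  2 < #|core_nbrs u| -> 2 < #|core_nbrs v| ->
  [/\ #|core_nbrs u| = 3, #|core_nbrs v| = 3 &
      forall a, a \in K -> a != u -> a != v -> #|core_nbrs a| = 2].
Proof.
move=> neq_uv uK vK u_gt2 v_gt2.
have sum_ge2 (A : {set V}) : A \subset K -> 2 * #|A| <= \sum_(a in A) #|core_nbrs a|.
  move=> /subsetP AK; rewrite mulnC -sum_nat_const; apply: leq_sum => a /AK.
  exact: core_nbrs_ge2.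
have vD : v \in K :\ u by rewrite in_setD1 eq_sym neq_uv.
have sumE : \sum_(a in K) #|core_nbrs a| =
    #|core_nbrs u| + (#|core_nbrs v| + \sum_(a in K :\ u :\ v) #|core_nbrs a|).
  by rewrite (big_setD1 u) //= (big_setD1 v).
have cardE : #|K| = (#|K :\ u :\ v|).+2.
  by rewrite (cardsD1 u) uK (cardsD1 v) vD.
have subK : K :\ u :\ v \subset K by rewrite (subset_trans (subsetDl _ _)) ?subsetDl.
have := sum_core_nbrs; rewrite sumE cardE.
have := sum_ge2 _ subK => sum_gt sumK.
split; try by move: u_gt2 v_gt2 sum_gt sumK; clear; lia.
move=> a aK neq_au neq_av.
have aD : a \in K :\ u :\ v by rewrite !in_setD1 neq_au neq_av.
have := sum_ge2 _ (subset_trans (subsetDl _ [set a]) subK).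
move: sumK; rewrite (big_setD1 a) //= (cardsD1 a (_ :\ v)) aD.
by move: u_gt2 v_gt2 (core_nbrs_ge2 aK); clear; lia.
Qed.

(** For a path with interior [P] towards [v], the vertex after the start is [head v P], which is [v]
    itself when the path is a single edge. *)
Lemma head_neq (v : V) P P' : uniq (v :: P ++ P') -> (P != [::]) || (P' != [::]) ->
  head v P != head v P'.
Proof.
case: P => [|a P]; case: P' => [|b P'] //= /andP[]; rewrite ?cats0.
- by rewrite inE negb_or => /andP[].
- by rewrite inE negb_or eq_sym => /andP[].
by rewrite mem_cat !inE !negb_or => _ /andP[] /and3P[].
Qed.

(** The assumptions on empty lists say that at most one of the paths is a single edge; hence the
    first steps lead to three different vertices. *)
Lemma hub_core_nbrs u v P1 P2 P3 :
    path e u (rcons P1 v) -> path e u (rcons P2 v) -> path e u (rcons P3 v) ->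
    uniq (v :: P1 ++ P2 ++ P3) -> {subset v :: P1 ++ P2 ++ P3 <= K} ->
    P3 != [::] -> (P1 != [::]) || (P2 != [::]) ->
  [/\ [set head v P1; head v P2; head v P3] \subset core_nbrs u,
      uniq [:: head v P1; head v P2; head v P3] &
      #|[set head v P1; head v P2; head v P3]| = 3].
Proof.
move=> p1 p2 p3 un inK P3n0 P12n0.
suff un_heads : uniq [:: head v P1; head v P2; head v P3].
  split=> //; last first.
    move: un_heads; rewrite /= !inE negb_or andbT => /andP[/andP[neq12 neq13] neq23].
    by rewrite -!setUA !cardsU1 cards1 !inE negb_or neq12 neq13 neq23.
  have headE P : path e u (rcons P v) -> {subset P <= v :: P1 ++ P2 ++ P3} ->
      head v P \in core_nbrs u.
    case: P => [|a P] /= /andP[eua _] PS; rewrite mem_core_nbrs eua inK ?inE ?eqxx //.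
    by rewrite -in_cons PS ?inE ?eqxx.
  by rewrite !subUset !sub1set !headE // => a aP; rewrite inE !mem_cat aP ?orbT.
have sub_uniq P P' : subseq (P ++ P') (P1 ++ P2 ++ P3) -> uniq (v :: P ++ P').
  by move=> sub; apply: (subseq_uniq _ un); rewrite /= eqxx.
have u12 : uniq (v :: P1 ++ P2) by apply: sub_uniq; rewrite catA prefix_subseq.
have u13 : uniq (v :: P1 ++ P3).
  by apply: sub_uniq; apply: cat_subseq => //; apply: suffix_subseq.
have u23 : uniq (v :: P2 ++ P3) by apply: sub_uniq; apply: suffix_subseq.
rewrite /= !inE !negb_or (head_neq u12) //.
by rewrite (head_neq u13) ?P3n0 ?orbT // (head_neq u23) // P3n0 orbT.
Qed.

(** * Three disjoint paths between two vertices exhaust the core *)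

Section ThreePaths.
Variables (u v : V) (P1 P2 P3 : seq V).
Hypotheses (path1 : path e u (rcons P1 v)) (path2 : path e u (rcons P2 v)).
Hypothesis path3 : path e u (rcons P3 v).
Hypothesis uniqS : uniq (u :: v :: P1 ++ P2 ++ P3).
Hypothesis subK : {subset u :: v :: P1 ++ P2 ++ P3 <= K}.
Hypotheses (P3n0 : P3 != [::]) (P12n0 : (P1 != [::]) || (P2 != [::])).

Let uniq_u : uniq (u :: P1 ++ P2 ++ P3).
Proof. by move: uniqS; rewrite /= inE negb_or -andbA => /and4P[_ -> _ ->]. Qed.

Let neq_uv : u != v.
Proof. by move: uniqS; rewrite /= inE negb_or -andbA => /andP[]. Qed.

Let perm_rev3 : perm_eq (rev P1 ++ rev P2 ++ rev P3) (P1 ++ P2 ++ P3).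
Proof. by apply/permP => q; rewrite !count_cat !count_rev. Qed.

Lemma three_paths_hub_rev :
  [/\ [set head u (rev P1); head u (rev P2); head u (rev P3)] \subset core_nbrs v,
      uniq [:: head u (rev P1); head u (rev P2); head u (rev P3)] &
      #|[set head u (rev P1); head u (rev P2); head u (rev P3)]| = 3].
Proof.
have revn0 P : (rev P != [::]) = (P != [::]) by rewrite -!size_eq0 size_rev.
apply: hub_core_nbrs; rewrite -?path_rev_rcons ?revn0 //.
  by rewrite (perm_uniq (s2 := u :: P1 ++ P2 ++ P3)) // perm_cons.
move=> a aS; apply: subK; move: aS; rewrite !in_cons (perm_mem perm_rev3).
by case/orP=> ->; rewrite ?orbT.
Qed.

Lemma three_paths_card : [/\ #|core_nbrs u| = 3, #|core_nbrs v| = 3 &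
  forall a, a \in K -> a != u -> a != v -> #|core_nbrs a| = 2].
Proof.
have u_gt2 : 2 < #|core_nbrs u|.
  have [||/subset_leq_card + _ cardE] := hub_core_nbrs path1 path2 path3 _ _ P3n0 P12n0.
  - by case/andP: uniqS.
  - by move=> a aS; apply: subK; rewrite in_cons aS orbT.
  by rewrite cardE.
have v_gt2 : 2 < #|core_nbrs v|.
  by have [/subset_leq_card + _ cardE] := three_paths_hub_rev; rewrite cardE.
by apply: two_hubs => //; apply: subK; rewrite !inE eqxx ?orbT.
Qed.

Lemma three_paths_nbrs_hub :
  core_nbrs u = [set head v P1; head v P2; head v P3].
Proof.
have [card_u _ _] := three_paths_card.
have [||sub _ cardE] := hub_core_nbrs path1 path2 path3 _ _ P3n0 P12n0.
- by case/andP: uniqS.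
- by move=> a aS; apply: subK; rewrite in_cons aS orbT.
by apply/esym/eqP; rewrite eqEcard sub card_u cardE.
Qed.

Lemma three_paths_path P : P \in [:: P1; P2; P3] -> path e u (rcons P v).
Proof. by rewrite !inE => /or3P[]/eqP->. Qed.

Lemma three_paths_sub P : P \in [:: P1; P2; P3] ->
  {subset P <= P1 ++ P2 ++ P3}.
Proof. by move=> + a aP; rewrite !inE !mem_cat => /or3P[]/eqP<-; rewrite aP ?orbT. Qed.

Lemma three_paths_uniq P : P \in [:: P1; P2; P3] -> uniq (u :: v :: P).
Proof.
move=> PP; apply: subseq_uniq uniqS; rewrite /= !eqxx.
move: PP; rewrite !inE => /or3P[]/eqP->; first exact: prefix_subseq.
  by apply: subseq_trans (suffix_subseq _ _); apply: prefix_subseq.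
by rewrite catA; apply: suffix_subseq.
Qed.

Lemma head_rcons (T : eqType) (x : T) s : head x s \in rcons s x.
Proof. by case: s => [|a s] /=; rewrite inE eqxx. Qed.

(** Predecessor and successor on the path are core neighbours, and [three_paths_card] leaves room
    for no other. *)
Lemma three_paths_nbrs_inner P l a m : P \in [:: P1; P2; P3] -> P = l ++ a :: m ->
  core_nbrs a = [set last u l; head v m].
Proof.
move=> PP defP; have [_ _ card2] := three_paths_card.
have PK b : b \in u :: rcons P v -> b \in K.
  rewrite in_cons mem_rcons in_cons => bP; apply: subK; rewrite !in_cons.
  by case/or3P: bP => [->|->|/(three_paths_sub PP)->]; rewrite ?orbT.
have unP : uniq ((u :: l) ++ a :: rcons m v).
  rewrite cat_cons -rcons_cons -rcons_cat -defP.
  by rewrite (perm_uniq (s2 := u :: v :: P)) ?three_paths_uniq // perm_cons perm_rcons.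
have pathP : path e u (l ++ a :: rcons m v).
  by rewrite -rcons_cons -rcons_cat -defP three_paths_path.
have memP : u :: rcons P v = (u :: l) ++ a :: rcons m v.
  by rewrite defP rcons_cat rcons_cons.
move: unP pathP; rewrite cat_uniq cat_path /= => /and4P[_ nhas anm _] /and3P[_ ela pam].
have eah : e a (head v m) by case: (m) pam => [|b m'] /= /andP[].
have headP : head v m \in u :: rcons P v.
  by rewrite memP mem_cat in_cons head_rcons !orbT.
have lastP : last u l \in u :: rcons P v by rewrite memP mem_cat mem_last.
have aK : a \in K by rewrite PK // memP mem_cat in_cons eqxx orbT.
have neq_lm : last u l != head v m.
  apply: contraNneq nhas => eq_lm; apply/orP; right; apply/hasP.
  by exists (head v m); rewrite ?head_rcons // /= -eq_lm mem_last.
have neq_au : a != u.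
  by apply: contraNneq nhas => ->; rewrite inE eqxx.
have neq_av : a != v.
  by apply: contraNneq anm => ->; rewrite mem_rcons inE eqxx.
apply/esym/eqP; rewrite eqEcard card2 // cards2 neq_lm subUset !sub1set !mem_core_nbrs.
by rewrite !PK // sym_e ela eah.
Qed.

Lemma three_paths_mem a : a \in u :: v :: P1 ++ P2 ++ P3 ->
  [\/ a = u, a = v | exists2 P, P \in [:: P1; P2; P3] & a \in P].
Proof.
rewrite !inE !mem_cat => /or3P[/eqP||]; try by [constructor|move/eqP; constructor].
by case/or3P=> aP; constructor; [exists P1|exists P2|exists P3]; rewrite ?inE ?eqxx ?orbT.
Qed.

Lemma three_paths_core_nbrs a : a \in u :: v :: P1 ++ P2 ++ P3 ->
  {subset core_nbrs a <= u :: v :: P1 ++ P2 ++ P3}.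
Proof.
have inS P b : P \in [:: P1; P2; P3] -> b \in u :: rcons P v ->
    b \in u :: v :: P1 ++ P2 ++ P3.
  move=> PP; rewrite in_cons mem_rcons !in_cons.
  by case/or3P=> [->|->|/(three_paths_sub PP)->]; rewrite ?orbT.
have P1P : P1 \in [:: P1; P2; P3] by rewrite inE eqxx.
have P2P : P2 \in [:: P1; P2; P3] by rewrite !inE eqxx orbT.
have P3P : P3 \in [:: P1; P2; P3] by rewrite !inE eqxx !orbT.
case/three_paths_mem=> [->|->|[P PP aP]] b.
- rewrite three_paths_nbrs_hub !inE -!orbA => /or3P[]/eqP->.
  + by apply: (inS P1); rewrite // inE head_rcons orbT.
  + by apply: (inS P2); rewrite // inE head_rcons orbT.
  + by apply: (inS P3); rewrite // inE head_rcons orbT.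
- have [sub _ cardE] := three_paths_hub_rev; have [_ card_v _] := three_paths_card.
  have <- : [set head u (rev P1); head u (rev P2); head u (rev P3)] = core_nbrs v.
    by apply/eqP; rewrite eqEcard sub cardE card_v.
  have head_revP P : head u (rev P) \in u :: rcons P v.
    have := head_rcons u (rev P); rewrite mem_rcons !inE mem_rev mem_rcons inE.
    by case/orP=> ->; rewrite ?orbT.
  rewrite !inE -!orbA => /or3P[]/eqP->.
  + exact: (inS P1).
  + exact: (inS P2).
  + exact: (inS P3).
case/splitPr defP: {1}P / aP => [l m].
rewrite (three_paths_nbrs_inner PP defP) !inE => /orP[]/eqP->; apply: (inS P) => //.
  rewrite defP rcons_cat -cat_cons mem_cat mem_last //.
by rewrite defP rcons_cat in_cons mem_cat rcons_cons in_cons head_rcons !orbT.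
Qed.

Lemma three_paths_linked P a b : P \in [:: P1; P2; P3] -> a \in P ->
  b \in core_nbrs a -> linked u (rcons P v) a b.
Proof.
move=> PP aP; case/splitPr defP: {1}P / aP => [l m].
rewrite (three_paths_nbrs_inner PP defP) ?defP rcons_cat rcons_cons.
rewrite /linked !steps_cat !mem_cat /steps /= -/(steps _ _) !inE.
by case/orP=> /eqP->; [|case: (m) => [|c m']]; rewrite /= ?inE eqxx ?orbT.
Qed.

Lemma three_paths_theta_core : theta_core u v P1 P2 P3.
Proof.
set S := u :: v :: P1 ++ P2 ++ P3.
have uS : u \in S by rewrite inE eqxx.
(* The paths together with the leaves attached to them are closed under adjacency, hence are
   everything. *)
pose W a := (a \in S) || ((a \notin K) && [exists b, (b \in S) && e a b]).
have coverW : forall a, W a.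
  apply: (@connected_closed W u) => [|a b]; first by rewrite /in_mem /= /W uS.
  rewrite /in_mem /= /W => /orP[aS|/andP[aK /existsP[c /andP[cS eac]]]] eab.
    have [bK|bK] := boolP (b \in K).
      by apply/orP; left; apply: (three_paths_core_nbrs aS); rewrite mem_core_nbrs bK eab.
    by apply/orP; right; apply/existsP; exists a; rewrite aS sym_e.
  have [d leafE] := leaf_nbr aK.
  by move: eac eab; rewrite !leafE => /eqP<- /eqP->; rewrite cS.
have KS : K =i S.
  move=> a; apply/idP/idP => [aK|/subK//].
  by have := coverW a; rewrite /W aK orbF.
split=> // [P l a m PP|a b|a aK]; first exact: three_paths_nbrs_inner; last first.
  have [b leafE] := leaf_nbr aK; exists b => //.
  by apply: (leaf_nbr_branching aK); rewrite leafE.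
rewrite !KS => aS bS eab.
have inner c d : c \in S -> d \in S -> e c d -> c != u -> c != v ->
    [|| linked u (rcons P1 v) c d, linked u (rcons P2 v) c d | linked u (rcons P3 v) c d].
  move=> cS dS ecd /eqP cu /eqP cv; case/three_paths_mem: cS => // -[P PP cP].
  have : linked u (rcons P v) c d.
    by apply: three_paths_linked; rewrite // mem_core_nbrs KS dS.
  by move: PP; rewrite !inE => /or3P[]/eqP->->; rewrite ?orbT.
have linkedC c d t : linked u t c d = linked u t d c by rewrite /linked orbC.
have [/andP[au av]|ahub] := boolP ((a != u) && (a != v)); first exact: inner.
have [/andP[bu bv]|bhub] := boolP ((b != u) && (b != v)).
  by rewrite !(linkedC a); apply: inner; rewrite // sym_e.
have {}ahub : (a == u) || (a == v) by move: ahub; rewrite negb_and !negbK.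
have {}bhub : (b == u) || (b == v) by move: bhub; rewrite negb_and !negbK.
(* An edge without an inner end joins [u] and [v]. Then [v] is the first vertex of some path, and
   that path is a single edge. *)
have hubs : e u v -> [|| linked u (rcons P1 v) u v, linked u (rcons P2 v) u v
    | linked u (rcons P3 v) u v].
  move=> euv; have : v \in core_nbrs u.
    by rewrite mem_core_nbrs euv KS !inE eqxx orbT.
  have empty P : P \in [:: P1; P2; P3] -> v == head v P -> linked u (rcons P v) u v.
    case: P => [|c P] PP /eqP defv; first by rewrite /linked inE eqxx.
    by have := three_paths_uniq PP; rewrite {1}defv /= !inE eqxx andbF.
  have -> : (v \in core_nbrs u) = [|| v == head v P1, v == head v P2 | v == head v P3].
    by rewrite three_paths_nbrs_hub !inE orbA.
  move=> /or3P[] defv; apply/or3P.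
  - by constructor 1; apply: empty; rewrite ?inE ?eqxx.
  - by constructor 2; apply: empty; rewrite ?inE ?eqxx ?orbT.
  by constructor 3; apply: empty; rewrite ?inE ?eqxx ?orbT.
case/orP: ahub bhub eab => /eqP-> /orP[]/eqP->; rewrite ?irr_e // sym_e.
by rewrite !(linkedC v).
Qed.

Section CycleThrough.
Variable D : seq V.
Hypotheses (cycD : ucycle e D) (D_gt2 : 2 < size D).

Lemma cycle_core_nbrs a : a \in D -> a != u -> a != v -> {subset core_nbrs a <= D}.
Proof.
move=> aD neq_au neq_av; have aK := ucycle_branching cycD D_gt2 aD.
have [_ _ /(_ a aK neq_au neq_av) card2] := three_paths_card.
have [b [c [neq_bc eab eac bD cD]]] := ucycle_nbrs sym_e cycD D_gt2 aD.
suff <- : [set b; c] = core_nbrs a by move=> d; rewrite !inE => /orP[]/eqP->.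
apply/eqP; rewrite eqEcard card2 cards2 neq_bc subUset !sub1set !mem_core_nbrs eab eac.
by rewrite !(ucycle_branching cycD).
Qed.

(** At a vertex of core degree 2 a cycle uses both core edges, so it cannot leave the path before
    [v]. *)
Lemma cycle_contains_path P : P \in [:: P1; P2; P3] -> head v P \in D ->
  {subset rcons P v <= D}.
Proof.
move=> PP; have unP := three_paths_uniq PP.
suff sub m l : P = l ++ m -> head v m \in D -> {subset rcons m v <= D}.
  exact: (sub P [::]).
elim: m l => [|a m IHm] l defP /= headD b; first by rewrite inE => /eqP->.
have aP : a \in P by rewrite defP mem_cat inE eqxx orbT.
move: unP => /=; rewrite inE negb_or -andbA => /and4P[_ unP vnP _].
have neq_au : a != u by apply: contraNneq unP => <-.
have neq_av : a != v by apply: contraNneq vnP => <-.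
rewrite inE => /orP[/eqP->//|]; apply: (IHm (rcons l a)); first by rewrite cat_rcons.
apply: (cycle_core_nbrs headD) => //.
by rewrite (three_paths_nbrs_inner PP defP) !inE eqxx orbT.
Qed.

Lemma cycle_contains_two_paths P P' : P \in [:: P1; P2; P3] -> P' \in [:: P1; P2; P3] ->
  uniq (P ++ P') -> u \in D -> head v P \in D -> head v P' \in D ->
  (size P + size P').+2 <= size D.
Proof.
move=> PP PP' unPP' uD hD hD'; rewrite -size_cat -[_.+2]/(size (u :: v :: P ++ P')).
have vD : v \in D by apply: (cycle_contains_path PP hD); rewrite mem_rcons inE eqxx.
apply: uniq_leq_size.
  have := three_paths_uniq PP; have := three_paths_uniq PP'; rewrite /= unPP' andbT.
  rewrite !inE !mem_cat !negb_or -!andbA => /and4P[-> -> -> _] /and4P[_ -> -> _].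
  by [].
move=> a; rewrite !inE mem_cat => /or4P[/eqP->|/eqP->|aP|aP'] //.
  by apply: (cycle_contains_path PP hD); rewrite mem_rcons inE aP orbT.
by apply: (cycle_contains_path PP' hD'); rewrite mem_rcons inE aP' orbT.
Qed.

End CycleThrough.

Lemma three_paths_uniq2 : [/\ uniq (P1 ++ P2), uniq (P1 ++ P3) & uniq (P2 ++ P3)].
Proof.
have := uniq_u => /= /andP[_ un]; split; apply: subseq_uniq un.
- by rewrite catA prefix_subseq.
- by apply: cat_subseq => //; apply: suffix_subseq.
- exact: suffix_subseq.
Qed.

Lemma three_paths_girth P P' : P \in [:: P1; P2; P3] -> P' \in [:: P1; P2; P3] ->
  uniq (P ++ P') -> (P != [::]) || (P' != [::]) -> g <= (size P + size P').+2.
Proof.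
move=> PP PP' unPP' nz.
have -> : (size P + size P').+2 = size (u :: P ++ v :: rev P').
  by rewrite /= size_cat /= size_rev addnS.
apply: (candidate_girth cand_e).
  by rewrite /= size_cat /= size_rev addnS !ltnS addn_gt0 !lt0n !size_eq0.
have pP := three_paths_path PP; have pP' := three_paths_path PP'.
rewrite path_rev_rcons // in pP'.
have unP := three_paths_uniq PP; have unP' := three_paths_uniq PP'.
rewrite /ucycle; apply/andP; split.
  rewrite /= -cat_rcons rcons_cat cat_path pP last_rcons.
  exact: pP'.
rewrite (perm_uniq (s2 := u :: v :: P ++ P')).
  move: unP unP'; rewrite /= unPP' andbT !inE !mem_cat !negb_or -!andbA.
  by move=> /and4P[-> -> -> _] /and4P[_ -> -> _].
by apply/permP => q; rewrite /= !count_cat /= count_rev; congr (_ + _); apply: addnCA.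
Qed.

End ThreePaths.

(** The lower bounds hold because two of the paths form a cycle. For the upper bounds, the first
    edges of [P3] and of another path lie on a cycle of length at most [g + 1], which must contain
    both paths. Likewise the first edge of [P3] lies on a cycle of length [g], which leaves [u]
    along [P1] or [P2]. *)
Lemma three_paths_sizes u v P1 P2 P3 :
    path e u (rcons P1 v) -> path e u (rcons P2 v) -> path e u (rcons P3 v) ->
    uniq (u :: v :: P1 ++ P2 ++ P3) -> {subset u :: v :: P1 ++ P2 ++ P3 <= K} ->
    P3 != [::] -> (P1 != [::]) || (P2 != [::]) ->
  [/\ g <= (size P1 + size P3).+2, g <= (size P2 + size P3).+2,
      (size P1 + size P3).+2 <= g.+1, (size P2 + size P3).+2 <= g.+1 &
      (size P1 + size P3).+2 <= g \/ (size P2 + size P3).+2 <= g].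
Proof.
move=> path1 path2 path3 un subK P3n0 P12n0.
have P1P : P1 \in [:: P1; P2; P3] by rewrite inE eqxx.
have P2P : P2 \in [:: P1; P2; P3] by rewrite !inE eqxx orbT.
have P3P : P3 \in [:: P1; P2; P3] by rewrite !inE eqxx !orbT.
have [_ un13 un23] := three_paths_uniq2 un.
have uK : u \in K by rewrite subK // inE eqxx.
have nbrsE := three_paths_nbrs_hub path1 path2 path3 un subK P3n0 P12n0.
have inN i : i \in [:: head v P1; head v P2; head v P3] -> (i \in K) && e u i.
  by rewrite -mem_core_nbrs nbrsE !inE orbA.
have [|| _ uniq_heads _] := hub_core_nbrs path1 path2 path3 _ _ P3n0 P12n0.
- by case/andP: un.
- by move=> a aS; apply: subK; rewrite in_cons aS orbT.
have [h1K eu1] := andP (inN (head v P1) (mem_head _ _)).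
have [h2K eu2] : head v P2 \in K /\ e u (head v P2).
  by apply/andP/inN; rewrite !inE eqxx orbT.
have [h3K eu3] : head v P3 \in K /\ e u (head v P3).
  by apply/andP/inN; rewrite !inE eqxx !orbT.
move: uniq_heads; rewrite /= !inE negb_or andbT => /andP[/andP[_]].
rewrite eq_sym => neq31; rewrite eq_sym => neq32.
have two := cycle_contains_two_paths path1 path2 path3 un subK P3n0 P12n0.
have size_gt2 b p : ucycle e [:: u, b & p] -> last b p != b -> 2 < size [:: u, b & p].
  by case: p => //=; rewrite eqxx.
split.
- by apply: (three_paths_girth path1 path2 path3 un P1P P3P); rewrite ?P3n0 ?orbT.
- by apply: (three_paths_girth path1 path2 path3 un P2P P3P); rewrite ?P3n0 ?orbT.
- have [p [cyc lastp le_g]] := cherry_on_cycle eu3 eu1 h3K h1K neq31.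
  apply: leq_trans le_g; apply: (two [:: u, head v P3 & p]) => //.
  + by apply: size_gt2 cyc _; rewrite lastp eq_sym.
  + by rewrite inE eqxx.
  + by rewrite -lastp in_cons mem_last orbT.
  by rewrite !inE eqxx orbT.
- have [p [cyc lastp le_g]] := cherry_on_cycle eu3 eu2 h3K h2K neq32.
  apply: leq_trans le_g; apply: (two [:: u, head v P3 & p]) => //.
  + by apply: size_gt2 cyc _; rewrite lastp eq_sym.
  + by rewrite inE eqxx.
  + by rewrite -lastp in_cons mem_last orbT.
  by rewrite !inE eqxx orbT.
have [p cyc sz] := edge_on_cycle eu3 uK h3K.
have c_gt2 : 2 < size [:: u, head v P3 & p] by rewrite /= sz.
have last_D : last (head v P3) p \in [:: u, head v P3 & p].
  by rewrite in_cons mem_last orbT.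
have : last (head v P3) p \in core_nbrs u.
  rewrite mem_core_nbrs (ucycle_branching cyc c_gt2 last_D) sym_e.
  by move: cyc; rewrite /ucycle /= rcons_path => /andP[/and3P[]].
have neq_last : last (head v P3) p != head v P3.
  case/andP: cyc => _ /=; case/lastP: (p) c_gt2 => // q c _.
  by rewrite last_rcons [c == _]eq_sym mem_rcons !inE !negb_or => /and3P[_ /andP[]].
rewrite nbrsE !inE (negbTE neq_last) orbF => /orP[]/eqP defl; [left|right]; rewrite -sz.
  apply: (two [:: u, head v P3 & p]) => //; first by rewrite inE eqxx.
    by rewrite -defl.
  by rewrite !inE eqxx orbT.
apply: (two [:: u, head v P3 & p]) => //; first by rewrite inE eqxx.
  by rewrite -defl.
by rewrite !inE eqxx orbT.
Qed.

(** The path lengths are [k.+1], [l.+1] and [m.+1]. If the first and third also add up to [g], then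
    the second and third are equal; their sum is [g] or [g + 1], so both are [uphalf g]. The other
    case is symmetric. *)
Lemma balanced_sizes k l m : (k + l).+2 = g -> g <= (k + m).+2 -> g <= (l + m).+2 ->
  (k + m).+2 <= g.+1 -> (l + m).+2 <= g.+1 -> (k + m).+2 <= g \/ (l + m).+2 <= g ->
  [/\ m.+1 = uphalf g & k.+1 = g./2 /\ l.+1 = uphalf g \/ l.+1 = g./2 /\ k.+1 = uphalf g].
Proof. clear; rewrite uphalf_half; have := odd_double_half g; lia. Qed.

(** Take a cycle [C] of length [g] through a vertex [u] of core degree at least 3 and a further core
    neighbour [z] of [u]. A cycle [D] through [z], [u] and a vertex of [C] is followed from [u]
    through [z] until it meets [C] again, at [v]. This piece of [D] and the two arcs of [C] are the
    three paths. *)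
Lemma exists_theta_core : exists u v P1 P2 P3,
  [/\ theta_core u v P1 P2 P3, (size P1).+1 = g./2,
      (size P2).+1 = uphalf g & (size P3).+1 = uphalf g].
Proof.
have [u uK u_gt2] := exists_hub.
have [a] : exists a, a \in core_nbrs u by apply/set0Pn; rewrite -card_gt0 ltnW 1?ltnW.
rewrite mem_core_nbrs => /andP[aK eua].
have [p cycC szC] := edge_on_cycle eua uK aK.
have C_gt2 : 2 < size [:: u, a & p] by rewrite /= szC.
have [z] : exists z, z \in core_nbrs u :\ a :\ last a p.
  apply/set0Pn; rewrite -card_gt0; move: u_gt2.
  rewrite (cardsD1 a) (cardsD1 (last a p) (_ :\ a)).
  by case: #|_ :\ _ :\ _| => //; case: (a \in _); case: (_ \in _ :\ a).
rewrite !in_setD1 mem_core_nbrs => /and4P[neq_zl neq_za zK euz].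
(* Otherwise the chord [uz] would cut off from [C] a cycle shorter than [g]. *)
have zC : z \notin [:: u, a & p].
  rewrite !inE !negb_or neq_za (contraTneq _ euz) => [|->]; last by rewrite irr_e.
  apply/negP => zp; move: cycC szC neq_zl; case/splitPr: zp => p1 [|c p2].
    by rewrite last_cat /= eqxx.
  move=> /andP[cycC unC] szC _.
  have un : uniq (u :: rcons (a :: p1) z).
    by move: unC; rewrite -cat_rcons -!cat_cons cat_uniq => /andP[].
  have short : size (u :: rcons (a :: p1) z) < g.
    by rewrite -szC /= size_rcons size_cat /=; clear; lia.
  apply/idP: short; rewrite -leqNgt; apply: (candidate_girth cand_e).
    by rewrite /= size_rcons.
  rewrite /ucycle un andbT.
  move: cycC; rewrite /= rcons_cat cat_path !rcons_path last_rcons /=.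
  by rewrite (sym_e z u) euz => /and4P[-> -> /andP[-> _] _].
have [q [cycD lastq _]] := cherry_on_cycle euz eua zK aK neq_za.
have D_gt2 : 2 < size [:: u, z & q].
  by case: (q) lastq => [|//] /= defz; rewrite defz eqxx in neq_za.
have hasC : has (mem [:: u, a & p]) (z :: q).
  by apply/hasP; exists (last z q); [apply: mem_last | rewrite lastq /= !inE eqxx orbT].
have subD b : b \in [:: u, z & q] -> b \in K by apply: ucycle_branching cycD D_gt2.
have subC b : b \in [:: u, a & p] -> b \in K by apply: ucycle_branching cycC C_gt2.
(* As [z] is off [C], the piece of [D] before the first hit is not empty. This is recorded here
   because [split_find] then abstracts that piece. *)
have P3n0' : ohead (take (find (mem [:: u, a & p]) (z :: q)) (z :: q)) = Some z.
  by rewrite /= (negbTE zC).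
move: cycD subD P3n0'; case: (split_find hasC) => v P3 D2 vC nP3C.
rewrite /ucycle -cats1 => /andP[cycD unD] subD P3n0'.
have P3n0 : P3 != [::] by case: (P3) P3n0'.
have path3 : path e u (rcons P3 v).
  by move: cycD; rewrite cats1 /= rcons_cat cat_path => /andP[].
have vu : v != u.
  by apply: contraTneq unD => ->; rewrite /= !mem_cat inE eqxx !orbT.
have vp : v \in a :: p by move: vC; rewrite /= in_cons (negbTE vu).
case/splitPr def_ap: {1}(a :: p) / vp => [P1 A2].
have C_E : [:: u, a & p] = u :: P1 ++ v :: A2 by rewrite def_ap.
have path1 : path e u (rcons P1 v).
  move: cycC; rewrite /ucycle C_E /= -cat_rcons rcons_cat cat_path.
  by case/andP=> /andP[].
have path2 : path e u (rcons (rev A2) v).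
  rewrite path_rev_rcons // revK.
  move: cycC; rewrite /ucycle C_E /= -cat_rcons rcons_cat cat_path last_rcons.
  by case/andP=> /andP[].
have permS : perm_eq (u :: v :: P1 ++ rev A2 ++ P3) ([:: u, a & p] ++ P3).
  rewrite C_E; apply/permP => r; rewrite /= !count_cat /= count_rev.
  by clear; lia.
have un : uniq (u :: v :: P1 ++ rev A2 ++ P3).
  rewrite (perm_uniq permS) cat_uniq nP3C; case/andP: cycC => _ -> /=.
  by move: unD; rewrite /= !cat_uniq => /and3P[_ /and3P[]].
have subK : {subset u :: v :: P1 ++ rev A2 ++ P3 <= K}.
  move=> b; rewrite (perm_mem permS) mem_cat => /orP[/subC//|bP].
  by apply: subD; rewrite in_cons !mem_cat bP !orbT.
have szE : (size P1 + size (rev A2)).+2 = g.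
  rewrite size_rev -szC -[(size p).+2]/(size [:: u, a & p]) C_E /= size_cat /=.
  by clear; lia.
have P12n0 : (P1 != [::]) || (rev A2 != [::]).
  by rewrite -!size_eq0 -negb_and -addn_eq0; apply: contraTneq g_ge3 => sz0; rewrite -szE sz0.
have := three_paths_sizes path1 path2 path3 un subK P3n0 P12n0.
have theta1 := three_paths_theta_core path1 path2 path3 un subK P3n0 P12n0.
case=> ge1 ge2 le1 le2 le12.
have [sz3 [] [sz1 sz2]] := balanced_sizes szE ge1 ge2 le1 le2 le12.
  by exists u, v, P1, (rev A2), P3.
by exists u, v, (rev A2), P1, P3; split=> //; apply: theta_core_swap12.
Qed.

End Structure.

(** * Sums over all edges from an explicit list *)

Section EdgeList.
Variables (V : finType) (e : rel V) (L : seq (V * V)).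

Lemma sum_count_mem (R : pzSemiRingType) (F : V -> V -> R) (M : seq (V * V)) :
  \sum_a \sum_b (count_mem (a, b) M)%:R * F a b = \sum_(c <- M) F c.1 c.2.
Proof.
elim: M => [|[a b] M IHM].
  by rewrite big_nil big1 // => a _; rewrite big1 // => b _; rewrite mul0r.
rewrite big_cons -IHM.
have -> : F a b = \sum_c \sum_d ((c, d) == (a, b))%:R * F c d.
  rewrite pair_bigA /= (bigD1 (a, b)) //= eqxx mul1r big1 ?addr0 // => -[c d] /negbTE.
  by rewrite -surjective_pairing => ->; rewrite mul0r.
rewrite -big_split; apply: eq_bigr => c _; rewrite -big_split; apply: eq_bigr => d _ /=.
by rewrite natrD mulrDl eq_sym.
Qed.

Hypothesis sym_e : symmetric e.
Hypothesis eL : forall a b, e a b -> ((a, b) \in L) || ((b, a) \in L).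
Hypothesis size_L : (\sum_a \sum_b (e a b : nat) = 2 * size L)%N.

(* By its length, the list [L] contains every edge exactly once. *)
Lemma sum_edge_list (R : comNzRingType) (F : V -> V -> R) :
  (forall a b, F a b = F b a) ->
  \sum_a \sum_b (e a b)%:R * F a b = 2 * \sum_(c <- L) F c.1 c.2.
Proof.
move=> symF; pose cnt a b := (count_mem (a, b) L + count_mem (b, a) L)%N.
have sum_cnt (S : comNzSemiRingType) (H : V -> V -> S) : (forall a b, H a b = H b a) ->
    \sum_a \sum_b (cnt a b)%:R * H a b = 2 * \sum_(c <- L) H c.1 c.2.
  move=> symH; rewrite mulr_natl mulr2n -!sum_count_mem.
  rewrite [X in _ = _ + X]exchange_big -big_split; apply: eq_bigr => a _ /=.
  rewrite -big_split; apply: eq_bigr => b _ /=.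
  by rewrite natrD mulrDl (symH b a).
have le_cnt a b : (e a b <= cnt a b)%N.
  case: (boolP (e a b)) => // /eL; rewrite /cnt addn_gt0 -!has_count.
  by rewrite !has_pred1.
(* Adjacency is bounded pointwise by the multiplicity in [L], and the totals agree, so equality
   holds everywhere. *)
have eq_cnt a b : e a b = cnt a b :> nat.
  have sumE : (\sum_a \sum_b cnt a b = 2 * size L)%N.
    rewrite -sum1_size; apply: etrans (sum_cnt nat (fun _ _ => 1%N) (fun _ _ => erefl)).
    by apply: eq_bigr => c _; apply: eq_bigr => d _; rewrite mulr1 natn.
  have := leqif_sum (fun i (_ : true) => leqif_eq (le_cnt i.1 i.2)).
  rewrite -(pair_bigA _ (fun a b => e a b : nat)) -(pair_bigA _ cnt) /= sumE size_L.
  by case=> _; rewrite eqxx => /esym/forallP/(_ (a, b))/eqP.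
rewrite -sum_cnt //; apply: eq_bigr => a _; apply: eq_bigr => b _.
by rewrite eq_cnt.
Qed.

End EdgeList.

(** * Consequences of maximality of [rho] for the eigenvector [x] *)

Section Extremal.
Variables (R : realType) (alpha r : R) (V : finType) (g : nat) (e : rel V) (x : V -> R).
Hypotheses (alpha_ge : 1 / 2 <= alpha) (alpha_lt1 : alpha < 1) (g_ge3 : (2 < g)%N).
Hypothesis cand_e : candidate g e.
Let sym_e := candidate_sym cand_e.
Let irr_e := candidate_irr cand_e.
(** Maximality of [r] in the form of Rayleigh quotients: none exceeds [r] on a candidate, and where
    [r] is reached the test vector satisfies the eigenvalue equation. *)
Hypothesis energy_le : forall e', candidate g e' ->
  forall y : V -> R, energy alpha e' y <= 2 * r * \sum_a y a ^+ 2.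
Hypothesis energy_eq : forall e', candidate g e' ->
  forall y : V -> R, energy alpha e' y = 2 * r * \sum_a y a ^+ 2 ->
  forall a, alpha_op alpha e' y a = r * y a.
Hypothesis x_gt0 : forall a, 0 < x a.
Hypothesis eig_x : forall a, alpha_op alpha e x a = r * x a.

Let alpha_gt0 : 0 < alpha.
Proof. by apply: lt_le_trans alpha_ge; rewrite divr_gt0. Qed.

Let beta_gt0 : 0 < 1 - alpha.
Proof. by rewrite subr_gt0. Qed.

Lemma energy_x : energy alpha e x = 2 * r * \sum_a x a ^+ 2.
Proof.
rewrite energy_alpha_op //; under eq_bigr do rewrite eig_x mulrCA -expr2.
by rewrite -mulr_sumr mulrA.
Qed.

(** If [x b <= x a], the move does not lower the energy of [x], so [x] satisfies the eigenvalue
    equation for [r] on the new graph as well. But at [a] the new edges add positive terms to that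
    equation. *)
Lemma move_edges_lt a b (N : {set V}) : a != b ->
    (forall y, y \in N -> [/\ e b y, y != a & ~~ e a y]) -> N != set0 ->
  candidate g (move_edges e a b N) -> x a < x b.
Proof.
move=> neq_ab NP Nn0 cand'; rewrite ltNge; apply/negP => le_ba.
set e' := move_edges e a b N.
have symF c d : edge_energy alpha (x c) (x d) = edge_energy alpha (x d) (x c).
  exact: edge_energyC.
have energy' : energy alpha e' x = 2 * r * \sum_c x c ^+ 2.
  apply/le_anti; rewrite energy_le //= -energy_x /energy.
  rewrite (sum_move_edges sym_e irr_e neq_ab NP symF) lerDl mulr_ge0 //.
  apply: sumr_ge0 => y _; rewrite /edge_energy.
  have -> : alpha * x a ^+ 2 + alpha * x y ^+ 2 + 2 * (1 - alpha) * x a * x y -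
      (alpha * x b ^+ 2 + alpha * x y ^+ 2 + 2 * (1 - alpha) * x b * x y) =
      (x a - x b) * (alpha * (x a + x b) + 2 * (1 - alpha) * x y) by ring.
  by rewrite mulr_ge0 ?subr_ge0 // ltW // addr_gt0 // !mulr_gt0 // addr_gt0.
have := energy_eq cand' energy' a; rewrite -eig_x => /eqP; rewrite gt_eqF //.
have [y yN] := set0Pn _ Nn0; have [eby _ eay] := NP y yN.
rewrite /alpha_op (bigD1 y) //= [ltRHS](bigD1 y) //= /e' move_edges_targetE // yN orbT.
rewrite (negbTE eay) mul0r mul1r ltr_leD //.
  by rewrite addr_gt0 ?mulr_gt0.
apply: ler_sum => z _; rewrite move_edges_targetE //; apply: ler_wpM2r.
  by rewrite addr_ge0 ?mulr_ge0 // ltW.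
by case: (e a z); case: (z \in N).
Qed.

Lemma branching_other a b : a \in branching e -> [set y | e a y & y != b] != set0.
Proof.
move=> /branchingP[y [z [neq_yz eay eaz]]]; apply/set0Pn.
have [yb|neq_yb] := eqVneq y b; last by exists y; rewrite inE eay.
by exists z; rewrite inE eaz -yb eq_sym.
Qed.

(** Otherwise the edge could be contracted towards either end, giving [x a < x b] and
    [x b < x a]. *)
Lemma extremal_edge_on_cycle a b : e a b -> a \in branching e -> b \in branching e ->
  exists2 p, ucycle e [:: a, b & p] & (size p).+2 = g.
Proof.
suff lt_of_long c d : e c d -> d \in branching e ->
    (forall p, ucycle e [:: c, d & p] -> (0 < size p)%N -> (g < (size p).+2)%N) ->
    x c < x d.
  move=> eab aK bK; apply: contrapT => no_cycle.
  have long p : ucycle e [:: a, b & p] -> (0 < size p)%N -> (g < (size p).+2)%N.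
    move=> cyc p_gt0; rewrite ltn_neqAle (candidate_girth cand_e (c := [:: a, b & p])) //.
    by rewrite andbT; apply/eqP => sz; apply: no_cycle; exists p.
  have long' p : ucycle e [:: b, a & p] -> (0 < size p)%N -> (g < (size p).+2)%N.
    by move=> /(ucycle_swap sym_e) cyc p_gt0; rewrite -size_rev long ?size_rev.
  have eba : e b a by rewrite sym_e.
  by have := lt_trans (lt_of_long a b eab bK long) (lt_of_long b a eba aK long'); rewrite ltxx.
move=> ecd dK long.
have neq_cd : c != d by apply: contraTneq ecd => ->; rewrite irr_e.
apply: (@move_edges_lt c d [set y | e d y & y != c]) => //.
- exact: (contract_movable g_ge3 cand_e ecd long).
- exact: branching_other.
exact: (contract_candidate g_ge3 cand_e ecd long).
Qed.

(** Otherwise [b] and [c] could be identified in either direction, giving [x b < x c] and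
    [x c < x b]. *)
Lemma extremal_cherry_on_cycle v b c : e v b -> e v c ->
    b \in branching e -> c \in branching e -> b != c ->
  exists p, [/\ ucycle e [:: v, b & p], last b p = c & ((size p).+2 <= g.+1)%N].
Proof.
suff lt_of_long a d : e v a -> e v d -> a != d -> d \in branching e ->
    (forall p, ucycle e [:: v, a & p] -> last a p = d -> (g.+1 < (size p).+2)%N) ->
    x a < x d.
  move=> evb evc bK cK neq_bc; apply: contrapT => no_cycle.
  have long p : ucycle e [:: v, b & p] -> last b p = c -> (g.+1 < (size p).+2)%N.
    by move=> cyc lastp; rewrite ltnNge; apply/negP => le_g; apply: no_cycle; exists p.
  have long' p : ucycle e [:: v, c & p] -> last c p = b -> (g.+1 < (size p).+2)%N.
    move=> /(ucycle_rev sym_e) cyc lastp; move: cyc; rewrite (lastI c p) lastp rev_rcons => cyc.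
    have := long _ cyc; rewrite size_rev size_belast; apply.
    case: p lastp {cyc} => [|d p] /=; first by move=> defb; rewrite defb eqxx in neq_bc.
    by rewrite rev_cons last_rcons.
  have neq_cb : c != b by rewrite eq_sym.
  have := lt_trans (lt_of_long b c evb evc neq_bc cK long)
    (lt_of_long c b evc evb neq_cb bK long').
  by rewrite ltxx.
move=> eva evd neq_ad dK long.
apply: (@move_edges_lt a d [set y | e d y & y != v]) => //.
- exact: (fold_movable g_ge3 cand_e eva evd neq_ad long).
- exact: branching_other.
exact: (fold_candidate g_ge3 cand_e eva evd neq_ad long).
Qed.

Lemma extremal_leaf_lt l w s : (forall c, e l c = (c == w)) -> s != w -> s != l -> x s < x w.
Proof.
move=> leafE neq_sw neq_sl; apply: (@move_edges_lt s w (set1 l)) => //.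
- move=> y /set1P->; rewrite sym_e leafE eqxx sym_e leafE eq_sym neq_sl; split=> //.
- by apply/set0Pn; exists l; rewrite inE.
apply: move_leaves_candidate => //; first by rewrite inE.
by move=> y z /set1P->.
Qed.

Section Theta.
Variables (u v w : V) (P1 P2 P3 : seq V).
Hypothesis theta : theta_core e u v P1 P2 P3.
Hypothesis leafE : forall l, l \notin branching e -> forall c, e l c = (c == w).

(** The steps of the three paths and the edges from [w] to the leaves cover all edges, and there are
    exactly [#|V| + 1] of them. *)
Lemma sum_theta_core (S : comNzRingType) (F : V -> V -> S) :
  (forall a b, F a b = F b a) ->
  \sum_a \sum_b (e a b)%:R * F a b =
  2 * (\sum_(c <- steps u (rcons P1 v)) F c.1 c.2 +
       \sum_(c <- steps u (rcons P2 v)) F c.1 c.2 +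
       \sum_(c <- steps u (rcons P3 v)) F c.1 c.2 +
       \sum_(l in ~: branching e) F w l).
Proof.
move=> symF; have [_ _ _ un mem_K _ lnk _] := theta.
pose L := steps u (rcons P1 v) ++ steps u (rcons P2 v) ++ steps u (rcons P3 v) ++
  [seq (w, l) | l <- enum (~: branching e)].
rewrite (@sum_edge_list _ _ L) //.
- by rewrite /L !big_cat big_map big_enum /= !addrA.
- move=> a b eab; have leafL c d : e c d -> c \notin branching e -> (d, c) \in L.
    move=> ecd cK; move: ecd; rewrite leafE // => /eqP->.
    by rewrite !mem_cat map_f ?orbT // mem_enum inE.
  have [aK|aK] := boolP (a \in branching e); last by rewrite (leafL a b) ?orbT.
  have [bK|bK] := boolP (b \in branching e); last by rewrite (leafL b a) // sym_e.
  rewrite /L !mem_cat; have := lnk a b aK bK eab.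
  by rewrite /linked => /or3P[]/orP[]->; rewrite ?orbT.
have size_steps a p : size (steps a p) = size p.
  by elim: p a => //= b p IHp a; rewrite /steps /= -/(steps _ _) IHp.
rewrite (candidate_arcs cand_e) /L !size_cat size_map -cardE !size_steps !size_rcons.
have <- := cardsC (branching e).
rewrite (eq_card mem_K) (card_uniqP un) /= !size_cat.
move: #|_| (size P1) (size P2) (size P3) => k1 k2 k3 k4; clear; lia.
Qed.

End Theta.

(** * Reversing the eigenvector along a path *)

Definition reverse_along (s : seq V) (a : V) : R :=
  if a \in s then nth 0 (rev (map x s)) (index a s) else x a.

Lemma reverse_along_map s : uniq s -> map (reverse_along s) s = rev (map x s).
Proof.
move=> un; case: s un => // a0 s' un; set s := a0 :: s' in un *.
apply: (@eq_from_nth _ 0) => [|i]; rewrite size_map ?size_rev ?size_map // => lt_i.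
by rewrite (nth_map a0) // /reverse_along mem_nth // index_uniq.
Qed.

Lemma reverse_along_out s a : a \notin s -> reverse_along s a = x a.
Proof. by rewrite /reverse_along => /negbTE->. Qed.

(** The values are only permuted, so the norm of the test vector is that of [x]. *)
Lemma sum_reverse_along s : uniq s ->
  \sum_a reverse_along s a ^+ 2 = \sum_a x a ^+ 2.
Proof.
move=> un; rewrite (bigID (mem s)) [RHS](bigID (mem s)) /=; congr (_ + _).
  rewrite -!big_uniq //= -(big_map (reverse_along s) xpredT (fun t => t ^+ 2)).
  rewrite reverse_along_map // -(big_map x xpredT (fun t => t ^+ 2)).
  by apply: perm_big; rewrite perm_rev.
by apply: eq_bigr => a /reverse_along_out->.
Qed.

Definition walk_energy (t : R) (p : seq R) : R :=
  \sum_(c <- steps t p) edge_energy alpha c.1 c.2.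

Lemma walk_energy_map (y : V -> R) a p :
  \sum_(c <- steps a p) edge_energy alpha (y c.1) (y c.2) = walk_energy (y a) (map y p).
Proof.
rewrite /walk_energy; elim: p a => [|b p IHp] a; first by rewrite /steps !big_nil.
by rewrite /steps /= -/(steps _ _) -/(steps _ _) !big_cons IHp.
Qed.

Lemma walk_energy_cat t p q :
  walk_energy t (p ++ q) = walk_energy t p + walk_energy (last t p) q.
Proof. by rewrite /walk_energy steps_cat big_cat. Qed.

Lemma walk_energy_rev t p t' :
  walk_energy t' (rcons (rev p) t) = walk_energy t (rcons p t').
Proof.
rewrite /walk_energy steps_rev (perm_big _ (permEl (perm_rev _))) big_map.
by apply: eq_bigr => c _; apply: edge_energyC.
Qed.

Lemma walk_energy_start t t' a p :
  walk_energy t (a :: p) - walk_energy t' (a :: p) =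
  edge_energy alpha t a - edge_energy alpha t' a.
Proof. by rewrite /walk_energy /steps /= !big_cons /=; ring. Qed.

Lemma map_rcons_head (y : V -> R) v p :
  exists q, map y (rcons p v) = y (head v p) :: q.
Proof. by case: p => [|a p] /=; eexists. Qed.

(* Compares [G] with the graph whose leaves are moved from [w] to [u], tested with the
   values of [x] reversed along the path from [u] to [w]. *)
Lemma swap_gain u v w P1 P2 P3 l m leaf :
    theta_core e u v P1 P2 P3 -> P1 = l ++ w :: m ->
    (forall l, l \notin branching e -> forall c, e l c = (c == w)) ->
    leaf \notin branching e ->
  alpha * (x w + x u) +
    2 * (1 - alpha) * (x (head v P2) + x (head v P3) - x (head v m)) <= 0.
Proof.
move=> theta defP1 leafE leafK; have [_ _ _ un mem_K _ _ _] := theta.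
have uK : u \in branching e by rewrite mem_K inE eqxx.
have wK : w \in branching e by rewrite mem_K defP1 !inE !mem_cat !inE eqxx !orbT.
pose s := u :: rcons l w; pose y := reverse_along s.
have un_all : uniq (s ++ m ++ v :: P2 ++ P3).
  rewrite (perm_uniq (s2 := u :: v :: P1 ++ P2 ++ P3)) // defP1 /s.
  by apply/permP => q; rewrite /= -cats1 !count_cat /= count_cat; clear; lia.
have un_s : uniq s by move: un_all; rewrite cat_uniq => /andP[].
have y_out a : a \in m ++ v :: P2 ++ P3 -> y a = x a.
  move=> a_out; apply: reverse_along_out; apply: contraL a_out => a_s.
  by move: un_all; rewrite cat_uniq => /and3P[_ /hasPn nhas _]; apply: contraL a_s => /nhas.
have neq_uw : u != w.
  by apply: contraTneq un_s => defu; rewrite /s defu /= mem_rcons inE eqxx.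
have [yu yl yw] : [/\ y u = x w, map y l = rev (map x l) & y w = x u].
  have := reverse_along_map un_s; rewrite /= !map_rcons rev_cons rev_rcons rcons_cons.
  by case=> yu /rcons_inj[yl yw]; split.
have lt_uw : x u < x w.
  apply: (extremal_leaf_lt (leafE _ leafK)) => //.
  by apply: contraNneq leafK => <-.
have sK a : a \in s -> a \in branching e.
  rewrite mem_K defP1 /s !in_cons mem_rcons in_cons => /or3P[->//|/eqP->|al].
    by rewrite !mem_cat inE eqxx !orbT.
  by rewrite !mem_cat al !orbT.
have y_leaf a : a \notin branching e -> y a = x a.
  by move=> aK; apply: reverse_along_out; apply: contra aK; apply: sK.
have NP a : a \in ~: branching e -> [/\ e w a, a != u & ~~ e u a].
  rewrite inE => aK; rewrite sym_e leafE // eqxx sym_e leafE // neq_uw; split=> //.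
  by apply: contraNneq aK => ->.
have cand' : candidate g (move_edges e u w (~: branching e)).
  apply: move_leaves_candidate => //; first by rewrite inE uK.
  by move=> a c; rewrite inE => /leafE->.
have := energy_le cand' y; rewrite sum_reverse_along // -energy_x /energy.
have symF (z : V -> R) a b : edge_energy alpha (z a) (z b) = edge_energy alpha (z b) (z a).
  exact: edge_energyC.
rewrite (sum_move_edges sym_e irr_e neq_uw NP (symF y)).
rewrite (sum_theta_core theta leafE (symF y)) (sum_theta_core theta leafE (symF x)).
rewrite !walk_energy_map sumrB.
(* The leaves, now at [u], see the value [y u = x w], as they did at [w]. *)
have -> : \sum_(a in ~: branching e) edge_energy alpha (y u) (y a) =
    \sum_(a in ~: branching e) edge_energy alpha (x w) (x a).
  by apply: eq_bigr => a; rewrite inE => /y_leaf->; rewrite yu.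
have map_out p : {subset p <= m ++ v :: P2 ++ P3} -> map y p = map x p.
  by move=> p_out; apply/eq_in_map => a /p_out/y_out.
have out_rcons p : {subset p <= m ++ v :: P2 ++ P3} ->
    map y (rcons p v) = map x (rcons p v).
  move=> p_out; apply: map_out => a; rewrite mem_rcons inE => /orP[/eqP->|/p_out//].
  by rewrite mem_cat inE eqxx orbT.
have walk1 z : map z (rcons P1 v) = map z (rcons l w) ++ map z (rcons m v).
  by rewrite defP1 -map_cat cat_rcons rcons_cat.
have seg_y : map y (rcons l w) = rcons (rev (map x l)) (x u) by rewrite map_rcons yl yw.
rewrite !walk1 !walk_energy_cat seg_y [map x (rcons l w)]map_rcons !last_rcons yu.
rewrite walk_energy_rev !out_rcons; last 3 first.
- by move=> a aP; rewrite !mem_cat inE mem_cat aP !orbT.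
- by move=> a aP; rewrite !mem_cat inE mem_cat aP !orbT.
- by move=> a am; rewrite mem_cat am.
have [q1 ->] := map_rcons_head x v m; have [q2 ->] := map_rcons_head x v P2.
have [q3 ->] := map_rcons_head x v P3.
have walkE a q : walk_energy (x w) (a :: q) =
    walk_energy (x u) (a :: q) + (edge_energy alpha (x w) a - edge_energy alpha (x u) a).
  by have := walk_energy_start (x w) (x u) a q => <-; ring.
(* The reversed segment keeps its energy. Only three edges change: those from [u] into [P2] and [P3]
   now start from [x w], and the one from [w] to [head v m] starts from [x u]. The difference has
   the factor [2 * (x w - x u)], which is positive. *)
rewrite !walkE -subr_ge0; set D := (X in 0 <= X -> _) => D_ge0.
have lt0_uw : 0 < 2 * (x w - x u) by rewrite mulr_gt0 ?subr_gt0.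
rewrite -(pmulr_rle0 _ lt0_uw) -oppr_ge0; apply: le_trans D_ge0 _.
rewrite le_eqVlt; apply/orP; left; apply/eqP.
by rewrite /D /edge_energy; ring.
Qed.

(** * Eigenvalue equations along the paths *)

Lemma sum_nbrs_le a s : uniq s -> (forall b, b \in s -> e a b) ->
  \sum_(b <- s) (alpha * x a + (1 - alpha) * x b) <= r * x a.
Proof.
move=> un es; rewrite -eig_x /alpha_op big_uniq // big_mkcond; apply: ler_sum => b _ /=.
case: ifP => [/es->|_]; first by rewrite mul1r.
by rewrite mulr_ge0 // addr_ge0 // mulr_ge0 // ltW.
Qed.

Lemma sum_nbrs_eq a s : uniq s -> (forall b, e a b = (b \in s)) ->
  \sum_(b <- s) (alpha * x a + (1 - alpha) * x b) = r * x a.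
Proof.
move=> un es; rewrite -eig_x /alpha_op big_uniq // big_mkcond; apply: eq_bigr => b _ /=.
by rewrite es; case: (b \in s); rewrite ?mul1r ?mul0r.
Qed.

Lemma inner_uniq u v P1 P2 P3 P l a m : theta_core e u v P1 P2 P3 ->
  P \in [:: P1; P2; P3] -> P = l ++ a :: m ->
  a \in branching e /\ uniq [:: last u l; head v m].
Proof.
move=> theta PP defP; have [_ _ _ un mem_K inner _ _] := theta.
have aK : a \in branching e.
  have aP : a \in P by rewrite defP mem_cat inE eqxx orbT.
  by rewrite mem_K !inE !mem_cat; move: PP; rewrite !inE => /or3P[]/eqP<-; rewrite aP ?orbT.
have := core_nbrs_ge2 g_ge3 cand_e extremal_edge_on_cycle aK.
by rewrite (inner P l a m) // cards2 ltnS lt0b => neq_lm; split=> //=; rewrite inE neq_lm.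
Qed.

(** An inequality only, because leaves at [a] would add positive terms; away from their neighbour
    [w], [inner_eq] gives equality. *)
Lemma inner_le u v P1 P2 P3 P l a m : theta_core e u v P1 P2 P3 ->
    P \in [:: P1; P2; P3] -> P = l ++ a :: m ->
  2 * alpha * x a + (1 - alpha) * (x (last u l) + x (head v m)) <= r * x a.
Proof.
move=> theta PP defP; have [aK un] := inner_uniq theta PP defP.
have := sum_nbrs_le (a := a) un; rewrite !big_cons big_nil addr0 => le_r.
apply: le_trans (le_r _); first by rewrite le_eqVlt; apply/orP; left; apply/eqP; ring.
move=> b b_nbr; have : b \in core_nbrs e a.
  by rewrite (theta_core_inner theta PP defP) !inE in b_nbr *.
by rewrite inE => /andP[].
Qed.

Lemma inner_eq u v w P1 P2 P3 P l a m : theta_core e u v P1 P2 P3 ->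
    (forall l, l \notin branching e -> forall c, e l c = (c == w)) ->
    P \in [:: P1; P2; P3] -> P = l ++ a :: m -> a != w ->
  2 * alpha * x a + (1 - alpha) * (x (last u l) + x (head v m)) = r * x a.
Proof.
move=> theta leafE PP defP neq_aw; have [aK un] := inner_uniq theta PP defP.
rewrite -(sum_nbrs_eq (a := a) un) => [|b]; first by rewrite !big_cons big_nil; ring.
have -> : (b \in [:: last u l; head v m]) = (b \in core_nbrs e a).
  by rewrite (theta_core_inner theta PP defP) !inE.
rewrite inE; case: (boolP (b \in branching e)) => //= /leafE/(_ a).
by rewrite sym_e (negbTE neq_aw) => ->.
Qed.

Lemma hub_le u v P1 P2 P3 : theta_core e u v P1 P2 P3 ->
    P3 != [::] -> (P1 != [::]) || (P2 != [::]) ->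
  3 * alpha * x u + (1 - alpha) * (x (head v P1) + x (head v P2) + x (head v P3)) <= r * x u.
Proof.
move=> theta P3n0 P12n0; have [p1 p2 p3 un mem_K _ _ _] := theta.
have [||/subsetP sub un_heads _] := hub_core_nbrs p1 p2 p3 _ _ P3n0 P12n0.
- by case/andP: un.
- by move=> a aS; rewrite mem_K in_cons aS orbT.
have := sum_nbrs_le (a := u) un_heads; rewrite !big_cons big_nil addr0 => le_r.
apply: le_trans (le_r _); first by rewrite le_eqVlt; apply/orP; left; apply/eqP; ring.
move=> b b_head; have : b \in core_nbrs e u by apply: sub; rewrite !inE -orbA in b_head *.
by rewrite inE => /andP[].
Qed.

(* If [x] more than halves in the first step, then by the recurrence it more than
   halves in every step. *)
Lemma decay u v P1 P2 P3 P : theta_core e u v P1 P2 P3 -> P \in [:: P1; P2; P3] ->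
    r < 2 * alpha + 5 / 2 * (1 - alpha) -> x (head v P) < x u / 2 ->
  x v < x u.
Proof.
move=> theta PP r_lt.
suff decay_from m l : P = l ++ m -> x (head v m) < x (last u l) / 2 -> x v < x (last u l).
  exact: (decay_from P [::]).
elim: m l => [|a m IHm] l defP /= lt_a.
  by apply: lt_trans lt_a _; rewrite ltr_pdivrMr // ltr_pMr // ltr1n.
(* Since [5 / 2 = 2 + 1 / 2], the values before and after [a] add up to less than [5 / 2 * x a]; the
   one before exceeds [2 * x a], so the one after is below [x a / 2]. *)
have lt_va : x v < x a.
  have := IHm (rcons l a); rewrite cat_rcons last_rcons; apply=> //.
  have le_a := inner_le theta PP defP.
  have lt_r : r * x a < (2 * alpha + 5 / 2 * (1 - alpha)) * x a by rewrite ltr_pM2r.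
  have lt_a' : (1 - alpha) * x a < (1 - alpha) * (x (last u l) / 2) by rewrite ltr_pM2l.
  rewrite -(ltr_pM2l beta_gt0); lra.
by apply: lt_trans lt_va (lt_trans lt_a _); rewrite ltr_pdivrMr // ltr_pMr // ltr1n.
Qed.

(** Suppose that [r] is smaller. If all three first vertices had values at least [x u / 2], the
    equation at [u] would force [alpha < 1 - alpha]. So [x] more than halves in the first step of
    some path and decays from [u] to [v]; by symmetry it also decays from [v] to [u]. *)
Lemma rho_ge u v P1 P2 P3 : theta_core e u v P1 P2 P3 ->
    P3 != [::] -> (P1 != [::]) || (P2 != [::]) ->
  2 * alpha + 5 / 2 * (1 - alpha) <= r.
Proof.
move=> theta P3n0 P12n0; rewrite leNgt; apply/negP => r_lt.
suff decay_hub a b Q1 Q2 Q3 : theta_core e a b Q1 Q2 Q3 -> Q3 != [::] ->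
    (Q1 != [::]) || (Q2 != [::]) -> x b < x a.
  have revn0 P : (rev P != [::]) = (P != [::]) by rewrite -!size_eq0 size_rev.
  have := decay_hub _ _ _ _ _ (theta_core_rev sym_e theta); rewrite !revn0 => /(_ P3n0 P12n0).
  by move/(lt_trans (decay_hub _ _ _ _ _ theta P3n0 P12n0)); rewrite ltxx.
move=> th Q3n0 Q12n0; have le_a := hub_le th Q3n0 Q12n0.
have dec Q : Q \in [:: Q1; Q2; Q3] -> x (head b Q) < x a / 2 -> x b < x a.
  by move=> QQ; apply: decay th QQ r_lt.
have [|ge1] := ltP (x (head b Q1)) (x a / 2); first by apply: dec; rewrite inE eqxx.
have [|ge2] := ltP (x (head b Q2)) (x a / 2); first by apply: dec; rewrite !inE eqxx orbT.
have [|ge3] := ltP (x (head b Q3)) (x a / 2); first by apply: dec; rewrite !inE eqxx !orbT.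
have lt_r : r * x a < (2 * alpha + 5 / 2 * (1 - alpha)) * x a by rewrite ltr_pM2r.
have le_sum : (1 - alpha) * (3 * (x a / 2)) <=
    (1 - alpha) * (x (head b Q1) + x (head b Q2) + x (head b Q3)).
  by rewrite ler_pM2l //; move: ge1 ge2 ge3; lra.
have : 1 / 2 * x a <= alpha * x a by rewrite ler_pM2r.
lra.
Qed.

(** By [rho_ge] the values before and after an inner vertex [a] other than [w] add up to at least
    [5 / 2 * x a]. Hence twice the current value minus the previous one, once positive, at least
    doubles with each step towards [v]. Its last instance is below [x v], so the first one is
    too. *)
Lemma middle_le u v w P1 P2 P3 l m : theta_core e u v P1 P2 P3 ->
    (forall l, l \notin branching e -> forall c, e l c = (c == w)) ->
    P1 = l ++ w :: m -> P3 != [::] -> x v <= x w ->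
  2 * x (head v m) <= x w + x v.
Proof.
move=> theta leafE defP1 P3n0 le_vw; have [_ _ _ un _ _ _ _] := theta.
have P1P : P1 \in [:: P1; P2; P3] by rewrite inE eqxx.
have r_ge : 2 * alpha + 5 / 2 * (1 - alpha) <= r.
  by apply: rho_ge theta P3n0 _; rewrite defP1; case: (l).
have grow m' l' : P1 = l' ++ m' -> w \notin m' -> m' != [::] ->
    x (last u l') < 2 * x (head v m') -> 2 * x (head v m') - x (last u l') <= x v.
  elim: m' l' => [|a m' IHm] l' defP //= wm _ lt_a.
  have neq_aw : a != w by apply: contraNneq wm => ->; rewrite inE eqxx.
  have eq_a := inner_eq theta leafE P1P defP neq_aw.
  have ge_a : (2 * alpha + 5 / 2 * (1 - alpha)) * x a <= r * x a by rewrite ler_pM2r.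
  have ge_next : 5 / 2 * x a <= x (last u l') + x (head v m').
    rewrite -(ler_pM2l beta_gt0); lra.
  have [m'0|m'n0] := eqVneq m' [::].
    by move: ge_next; rewrite m'0 /=; have := x_gt0 a; lra.
  have := IHm (rcons l' a); rewrite cat_rcons last_rcons => /(_ defP _ m'n0).
  have -> : w \notin m' by apply: contra wm; rewrite inE orbC => ->.
  have := x_gt0 a; move=> xa_gt0 /(_ isT); lra.
(* For empty [m] the vertex [head v m] is [v], and the claim reduces to [x v <= x w]. *)
have [m0|mn0] := eqVneq m [::]; first by rewrite m0 /=; lra.
have wm : w \notin m.
  move: un; rewrite defP1 /= -catA cat_uniq => /and3P[_ _ /and3P[_ _]] /=.
  by rewrite mem_cat negb_or => /andP[/andP[]].
have := grow m (rcons l w); rewrite cat_rcons last_rcons => /(_ defP1 wm mn0).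
by have := x_gt0 v; case: (ltP (x w) (2 * x (head v m))) => [_ xv_gt0 /(_ isT)|]; lra.
Qed.

(** By [middle_le], [2 * x (head v m) <= x w + x v <= x w + x u]. As [1 - alpha <= alpha], the term
    [alpha * (x w + x u)] then outweighs the only negative term in [swap_gain], and the values on
    [P2] and [P3] make the sum positive. *)
Lemma leaves_not_inner_sym u v w P1 P2 P3 l m leaf :
    theta_core e u v P1 P2 P3 -> P1 = l ++ w :: m -> P3 != [::] -> x v <= x u ->
    (forall l, l \notin branching e -> forall c, e l c = (c == w)) ->
  leaf \notin branching e -> False.
Proof.
move=> theta defP1 P3n0 le_vu leafE leafK.
have [_ _ _ un mem_K _ _ _] := theta.
have vK : v \in branching e by rewrite mem_K !inE eqxx orbT.
have neq_vw : v != w.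
  move: un; rewrite /= => /and3P[_ + _]; apply: contraNneq => ->.
  by rewrite defP1 !mem_cat inE eqxx !orbT.
have le_vw : x v <= x w.
  apply: ltW (extremal_leaf_lt (leafE _ leafK) neq_vw _).
  by apply: contraNneq leafK => <-.
have := swap_gain theta defP1 leafE leafK.
have := middle_le theta leafE defP1 P3n0 le_vw.
have := x_gt0 (head v P2); have := x_gt0 (head v P3); have xu := x_gt0 u; have xw := x_gt0 w.
move=> h3 h2 le_mid.
have : (1 - alpha) * (x w + x u) <= alpha * (x w + x u).
  by rewrite ler_pM2r ?addr_gt0 //; have := alpha_ge; lra.
have : 0 < (1 - alpha) * (x w + x u + 2 * (x (head v P2) + x (head v P3) - x (head v m))).
  by rewrite mulr_gt0 //; lra.
lra.
Qed.

(** Reversing all paths, if necessary, makes [u] the end with the larger value. *)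
Lemma leaves_not_inner u v w P1 P2 P3 leaf :
    theta_core e u v P1 P2 P3 -> w \in P1 -> P3 != [::] ->
    (forall l, l \notin branching e -> forall c, e l c = (c == w)) ->
  leaf \notin branching e -> False.
Proof.
move=> theta wP1 P3n0 leafE leafK; have [le_vu|lt_uv] := leP (x v) (x u).
  case/splitPr defP1: {1}P1 / wP1 => [l m].
  exact: leaves_not_inner_sym theta defP1 P3n0 le_vu leafE leafK.
have wP1' : w \in rev P1 by rewrite mem_rev.
case/splitPr defP1: {1}(rev P1) / wP1' => [l m].
apply: leaves_not_inner_sym (theta_core_rev sym_e theta) defP1 _ (ltW lt_uv) leafE leafK.
by rewrite -size_eq0 size_rev size_eq0.
Qed.

End Extremal.

(** * A theta core with all leaves at one end is isomorphic to the model *)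

Section ThetaIsomorphism.
Local Open Scope nat_scope.
Variables (V : finType) (e : rel V).
Hypotheses (sym_e : symmetric e) (irr_e : irreflexive e).
Variables (u v : V) (P1 P2 P3 : seq V).
Hypothesis theta : theta_core e u v P1 P2 P3.
Local Notation K := (branching e).
Hypothesis leafE : forall l, l \notin K -> forall c, e l c = (c == u).

Let p := (size P1).+1.
Let q := (size P2).+1.
Let r := (size P3).+1.
Local Notation H := (theta_pendant p q r #|~: K|).

Let arm (i : 'I_3) : seq V := tnth [tuple P1; P2; P3] i.

Let size_arm i : size (arm i) = (theta_len p q r i).-1.
Proof. by case: i => [[|[|[|i]]] lt_i]. Qed.

Let theta_len_gt0 i : 0 < theta_len p q r i.
Proof. by case: i => [[|[|[|i]]] lt_i]. Qed.

Let arm_mem i : arm i \in [:: P1; P2; P3].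
Proof. exact: mem_tnth. Qed.

(** The map goes from the model to [V], where it can be read off the lists; the default [u] of [nth]
    is never reached. *)
Let theta_emb (a : theta_vertex p q r) : V :=
  match a with
  | inl false => u
  | inl true => v
  | inr (existT i j) => nth u (arm i) j
  end.

Let emb (a : H) : V :=
  match a with
  | inl b => theta_emb b
  | inr j => nth u (enum (~: K)) j
  end.

(** [theta_path] falls back to the terminal vertex at every position past the interior, which agrees
    with the list up to [k = theta_len p q r i]. *)
Let theta_emb_path i k : k <= theta_len p q r i ->
  theta_emb (theta_path p q r i k) = nth u (u :: rcons (arm i) v) k.
Proof.
case: k => [//|k] lt_k /=; rewrite nth_rcons size_arm.
case: insubP => [j lt_j def_j|]; first by rewrite lt_j -def_j.
rewrite -leqNgt => ge_k; rewrite ltnNge ge_k /=.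
by rewrite eqn_leq ge_k andbT -ltnS prednK // lt_k.
Qed.

Let theta_emb_branching a : theta_emb a \in K.
Proof.
have [_ _ _ _ mem_K _ _ _] := theta; rewrite mem_K.
case: a => [[]|[i j]] /=; rewrite ?inE ?eqxx ?orbT //.
have lt_j : j < size (arm i) by rewrite size_arm.
have := mem_nth u lt_j; move: (arm_mem i); rewrite !inE !mem_cat.
by case/or3P=> /eqP-> ->; rewrite ?orbT.
Qed.

Let emb_surj a : exists b, emb b = a.
Proof.
have [aK|aK] := boolP (a \in K); last first.
  have a_leaf : a \in enum (~: K) by rewrite mem_enum inE.
  have lt_i : index a (enum (~: K)) < #|~: K| by rewrite cardE index_mem.
  by exists (inr (Ordinal lt_i)); rewrite /= nth_index.
have [_ _ _ _ mem_K _ _ _] := theta.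
have in_arm i : a \in arm i -> exists b, emb b = a.
  move=> a_arm; have lt_j : index a (arm i) < (theta_len p q r i).-1.
    by rewrite -size_arm index_mem.
  by exists (inl (inr (Tagged (fun h => 'I_(theta_len p q r h).-1) (Ordinal lt_j))));
    rewrite /= nth_index.
move: aK; rewrite mem_K !inE !mem_cat => /orP[/eqP->|/orP[/eqP->|/or3P[]]].
- by exists (inl (inl false)).
- by exists (inl (inl true)).
- by move=> aP; apply: (in_arm (inord 0)); rewrite /arm (tnth_nth [::]) inordK.
- by move=> aP; apply: (in_arm (inord 1)); rewrite /arm (tnth_nth [::]) inordK.
by move=> aP; apply: (in_arm (inord 2)); rewrite /arm (tnth_nth [::]) inordK.
Qed.

Let card_H : #|H| = #|V|.
Proof.
have [_ _ _ un mem_K _ _ _] := theta.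
rewrite -(cardsC K) (eq_card mem_K) (card_uniqP un) /= card_sum card_ord.
congr (_ + _); rewrite card_sum card_bool card_tagged.
rewrite (eq_map (g := fun i => (theta_len p q r i).-1)) => [|i]; last by rewrite card_ord.
by rewrite sumnE big_map big_enum /= !big_ord_recl big_ord0 !size_cat addn0.
Qed.

(** A surjection between finite sets of equal size. *)
Let emb_bij : bijective emb.
Proof.
have inj_emb : injective emb.
  apply/injectiveP/card_uniqP; rewrite size_codom card_H; apply: eq_card => a.
  by have [b <-] := emb_surj a; rewrite codom_f.
exact: inj_card_bij inj_emb (eq_leq (esym card_H)).
Qed.

Lemma theta_isomorphic : isomorphic (SGraph sym_e irr_e) H.
Proof.
have [h embK hK] := emb_bij.
have inj_emb := bij_inj emb_bij.
suff emb_adj a b : adj a b = e (emb a) (emb b).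
  by exists h => [|a b]; [exists emb | rewrite emb_adj !hK].
have [p1 p2 p3 _ _ _ lnk _] := theta.
have path_arm i : path e u (rcons (arm i) v).
  by have := arm_mem i; rewrite !inE => /or3P[]/eqP->.
have leaf_branching j : nth u (enum (~: K)) j \in K -> (j < #|~: K|) = false.
  move=> inK; apply/negbTE/negP => lt_j; have := mem_nth u (s := enum (~: K)) (n := j).
  by rewrite -cardE lt_j => /(_ isT); rewrite mem_enum inE inK.
have leaf_nth (j : 'I_#|~: K|) : nth u (enum (~: K)) j \notin K.
  by apply/negP => /leaf_branching; rewrite ltn_ord.
have arc_e c d : theta_arc c d -> e (theta_emb c) (theta_emb d).
  case/existsP=> i /existsP[k /andP[/eqP-> /eqP->]].
  rewrite (theta_emb_path (ltnW (ltn_ord k))) (theta_emb_path (ltn_ord k)).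
  have size_i : size (rcons (arm i) v) = theta_len p q r i.
    by rewrite size_rcons size_arm prednK.
  by have /pathP := path_arm i; apply; rewrite size_i.
have steps_arc i c d : (theta_emb c, theta_emb d) \in steps u (rcons (arm i) v) ->
    theta_arc c d.
  have inj_theta : injective theta_emb
    by move=> c' d' eq_cd; have [] := inj_emb (inl c') (inl d') eq_cd.
  move=> /(steps_nth u)[k]; rewrite size_rcons size_arm prednK // => lt_k [eq_c eq_d].
  apply/existsP; exists i; apply/existsP; exists (Ordinal lt_k); apply/andP; split; apply/eqP.
    by apply: inj_theta; rewrite eq_c theta_emb_path // ltnW.
  by apply: inj_theta; rewrite eq_d theta_emb_path.
have linked_adj i c d : linked u (rcons (arm i) v) (theta_emb c) (theta_emb d) -> theta_adj c d.
  by case/orP=> /steps_arc arc_cd; rewrite /theta_adj arc_cd ?orbT.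
case: a b => [a|j] [b|k] /=.
- apply/idP/idP => [/orP[/arc_e//|/arc_e]|]; first by rewrite sym_e.
  move=> /(lnk _ _ (theta_emb_branching a) (theta_emb_branching b)).
  have -> : P1 = arm (inord 0) by rewrite /arm (tnth_nth [::]) inordK.
  have -> : P2 = arm (inord 1) by rewrite /arm (tnth_nth [::]) inordK.
  have -> : P3 = arm (inord 2) by rewrite /arm (tnth_nth [::]) inordK.
  by case/or3P; [exact: linked_adj ..].
- rewrite sym_e leafE //; apply/eqP/eqP => [->//|eq_au].
  by have [] := inj_emb (inl a) (inl (inl false)) eq_au.
- rewrite leafE //; apply/eqP/eqP => [->//|eq_bu].
  by have [] := inj_emb (inl b) (inl (inl false)) eq_bu.
rewrite leafE //; apply/esym/negbTE; apply: contraNneq (leaf_nth k) => ->.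
exact: (theta_emb_branching (inl false)).
Qed.

End ThetaIsomorphism.

(** * Counting arcs and pendant vertices *)

Section Handshake.
Local Open Scope nat_scope.

(** The map from ordered pairs to unordered edges has fibres of size two, since there are no
    loops. *)
Lemma sum_adj (G : sgraph) : \sum_(a : G) \sum_b (adj a b : nat) = 2 * #|edges G|.
Proof.
rewrite (pair_bigA _ (fun a b : G => adj a b : nat)) /= -sum1_card.
rewrite (eq_bigr (fun p : G * G => if adj p.1 p.2 then 1 else 0)) => [|p _]; last first.
  by case: (adj _ _).
rewrite -big_mkcond (partition_big (fun p : G * G => [set p.1; p.2]) (mem (edges G))) /=.
  rewrite big_distrr /=; apply: eq_bigr => E; rewrite inE.
  case/existsP=> a /existsP[b /andP[ab /eqP->]].
  have neq_ab : a != b by apply: contraTneq ab => ->; rewrite adj_irrefl.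
  rewrite sum1dep_card muln1.
  have -> : [set p : G * G | adj p.1 p.2 & [set p.1; p.2] == [set a; b]] = [set (a, b); (b, a)].
    apply/setP => -[c d]; rewrite !inE /= !xpair_eqE.
    apply/andP/orP => [[cd /eqP/setP eq_cd]|[]/andP[/eqP-> /eqP->]]; last 2 first.
    - by rewrite ab eqxx.
    - by rewrite adj_sym ab setUC eqxx.
    have neq_cd : c != d by apply: contraTneq cd => ->; rewrite adj_irrefl.
    have := eq_cd c; have := eq_cd d; rewrite !inE !eqxx orbT /=.
    by case/esym/orP=> /eqP defd /esym/orP[]/eqP defc; move: neq_cd; rewrite defc defd ?eqxx //;
      [right | left].
  by rewrite cards2 xpair_eqE (negbTE neq_ab).
move=> [a b] /= ab; rewrite inE; apply/existsP; exists a; apply/existsP; exists b.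
by rewrite ab eqxx.
Qed.

End Handshake.

(** The three path lengths add up to [uphalf (3 * g)], and a theta graph has one vertex less than
    edges. *)
Lemma pendant_count (k1 k2 k3 t n g : nat) :
    k1.+1 = g./2 -> k2.+1 = uphalf g -> k3.+1 = uphalf g ->
  ((k1 + (k2 + k3)).+2 + t = n -> t = n + 1 - uphalf (3 * g))%N.
Proof.
rewrite uphalf_half [uphalf (3 * g)]uphalf_half oddM /=.
have := odd_double_half g; have := odd_double_half (3 * g); rewrite oddM /=; lia.
Qed.

Definition candidate_graph (V : finType) (g : nat) (e : rel V) (c : candidate g e) : sgraph :=
  SGraph (candidate_sym c) (candidate_irr c).

(** * A candidate with maximal [rho] is the extremal graph *)

Section Maximal.
Variables (R : realType) (alpha : R) (V : finType) (g : nat).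
Hypotheses (alpha_ge : 1 / 2 <= alpha) (alpha_lt1 : alpha < 1) (g_ge3 : (2 < g)%N).

Lemma candidate_card_gt0 (e : rel V) : candidate g e -> (0 < #|V|)%N.
Proof.
move=> c; rewrite lt0n; apply/eqP => /eqP V0; have := candidate_arcs c.
have no_vertex (a : V) : False by move: V0; rewrite (cardD1 a).
by rewrite big1 => [|a]; [rewrite addn2 | case: (no_vertex a)].
Qed.

Lemma candidate_connected (e : rel V) (c : candidate g e) :
  connected_graph (candidate_graph c).
Proof. by split; [apply: candidate_card_gt0 c | apply: candidate_conn c]. Qed.

Lemma maximal_isomorphic (e : rel V) (c : candidate g e) :
    (forall (e' : rel V) (c' : candidate g e'),
       rho alpha (candidate_graph c') <= rho alpha (candidate_graph c)) ->
  isomorphic (candidate_graph c)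
    (theta_pendant g./2 (uphalf g) (uphalf g) (#|V| + 1 - uphalf (3 * g))).
Proof.
move=> max_c; set rc := rho alpha (candidate_graph c).
have V_gt0 (e' : rel V) (c' : candidate g e') : (0 < #|candidate_graph c'|)%N.
  exact: candidate_card_gt0 c'.
have [x x_gt0 eig_x] : exists2 x : V -> R, (forall a, 0 < x a) &
    forall a, alpha_op alpha e x a = rc * x a.
  exact: exists_Perron (V_gt0 _ c) alpha_lt1 (candidate_connected c).
have sq_ge0 (y : V -> R) : 0 <= \sum_a y a ^+ 2 by apply: sumr_ge0 => a _; apply: sqr_ge0.
have energy_le e' : candidate g e' -> forall y : V -> R,
    energy alpha e' y <= 2 * rc * \sum_a y a ^+ 2.
  move=> c' y; apply: le_trans (energy_le_rho alpha (V_gt0 _ c') y) _.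
  by apply: ler_wpM2r; [exact: sq_ge0 | apply: ler_wpM2l => //; exact: max_c].
have energy_eq e' : candidate g e' -> forall y : V -> R,
    energy alpha e' y = 2 * rc * \sum_a y a ^+ 2 ->
    forall a, alpha_op alpha e' y a = rc * y a.
  move=> c' y defy a.
  (* A nonzero [y] forces the other graph to have [rho] equal to [rc]; for [y = 0] both sides of the
     equation vanish. *)
  have [y0|y_neq0] := eqVneq (\sum_a y a ^+ 2) 0.
    have {}y0 b : y b = 0.
      apply/eqP; rewrite -sqrf_eq0; move/eqP: y0;
      rewrite psumr_eq0 => [|d _]; last exact: sqr_ge0.
      by move/allP/(_ b (mem_index_enum b)).
    by rewrite y0 mulr0 /alpha_op big1 // => b _; rewrite !y0 !mulr0 addr0 mulr0.
  have rhoE : rho alpha (candidate_graph c') = rc.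
    have S_gt0 : 0 < \sum_a y a ^+ 2 by rewrite lt_def y_neq0 sq_ge0.
    have : energy alpha e' y <= 2 * rho alpha (candidate_graph c') * \sum_a y a ^+ 2 :=
      energy_le_rho alpha (V_gt0 _ c') y.
    move: (max_c _ c'); rewrite defy; move: (rho alpha (candidate_graph c')) => s le_s.
    by rewrite -!mulrA ler_pM2l // ler_pM2r // => ge_s; apply/le_anti; rewrite le_s.
  rewrite -rhoE; apply: (energy_eq_rho (V_gt0 _ c')).
  by rewrite rhoE.
have edge_cyc := extremal_edge_on_cycle alpha_ge alpha_lt1 g_ge3 c energy_le energy_eq
  x_gt0 eig_x.
have cherry_cyc := extremal_cherry_on_cycle alpha_ge alpha_lt1 g_ge3 c energy_le energy_eq
  x_gt0 eig_x.
have leaf_lt := extremal_leaf_lt alpha_ge alpha_lt1 c energy_le energy_eq x_gt0 eig_x.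
have not_inner := leaves_not_inner alpha_ge alpha_lt1 g_ge3 c energy_le energy_eq x_gt0 eig_x.
have sym_e := candidate_sym c.
have [u [v [P1 [P2 [P3 [theta sz1 sz2 sz3]]]]]] :=
  exists_theta_core g_ge3 c edge_cyc cherry_cyc.
(* It suffices to find a labelling of the theta core in which all leaves hang at [u]. *)
wlog leafE : u v P1 P2 P3 theta sz1 sz2 sz3 /
    forall l, l \notin branching e -> forall b, e l b = (b == u).
  move=> hub; have [_ _ _ un mem_K _ _ leaf_nbr] := theta.
  have [no_leaf|] := eqVneq (~: branching e) set0.
    apply: (hub u v P1 P2 P3) => // l lK.
    by have /setP/(_ l) := no_leaf; rewrite in_setC in_set0 lK.
  case/set0Pn=> l; rewrite in_setC => lK; have [w wK lE] := leaf_nbr l lK.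
  (* If two leaves had different neighbours, each neighbour would have a larger value than the
     other. *)
  have leafE l' : l' \notin branching e -> forall b, e l' b = (b == w).
    move=> l'K b; have [w' w'K l'E] := leaf_nbr l' l'K.
    have [<-//|neq_ww'] := eqVneq w' w.
    have lt1 : x w' < x w by apply: leaf_lt lE _ _ => //; apply: contraNneq lK => <-.
    have lt2 : x w < x w'.
      by apply: leaf_lt l'E _ _; rewrite 1?eq_sym //; apply: contraNneq l'K => ->.
    by have := lt_trans lt1 lt2; rewrite ltxx.
  (* [P2] and [P3] have inner vertices, while [P1] is empty for [g = 3]. *)
  have g2 : (1 < uphalf g)%N by rewrite uphalfE geq_half_double.
  have P2n0 : P2 != [::] by rewrite -size_eq0; apply: contraTneq g2 => sz0; rewrite -sz2 sz0.
  have P3n0 : P3 != [::] by rewrite -size_eq0; apply: contraTneq g2 => sz0; rewrite -sz3 sz0.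
  move: wK; rewrite mem_K !inE !mem_cat => /orP[/eqP wu|/orP[/eqP wv|/or3P[]]] //.
  - by apply: (hub u v P1 P2 P3) => //; rewrite -wu.
  - rewrite wv in leafE.
    by apply: (hub v u (rev P1) (rev P2) (rev P3)); rewrite ?size_rev //; apply: theta_core_rev.
  - by move=> wP; case: (not_inner _ _ _ _ _ _ _ theta wP P3n0 leafE lK).
  - by move=> wP; case: (not_inner _ _ _ _ _ _ _ (theta_core_swap12 theta) wP P3n0 leafE lK).
  (* The path in the third place must be nonempty, so [P2] rather than [P1] is put there. *)
  move=> wP; have theta' := theta_core_swap13 (theta_core_swap12 theta).
  by case: (not_inner _ _ _ _ _ _ _ theta' wP P2n0 leafE lK).
have := theta_isomorphic (candidate_sym c) (candidate_irr c) theta leafE.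
have [_ _ _ un mem_K _ _ _] := theta.
have := cardsC (branching e); rewrite (eq_card mem_K) (card_uniqP un) /= !size_cat.
by move=> /(pendant_count sz1 sz2 sz3) ->; rewrite sz1 sz2 sz3.
Qed.

End Maximal.

Theorem theorem4p4 (R : realType) (n g : nat)
    (hn : (uphalf (3 * g) - 1 <= n)%N)
    (G : sgraph) (hG : bicyclic G) (ordG : #|G| = n) (girthG : has_girth G g)
    (alpha : R) (halpha : 1 / 2 <= alpha < 1) :
  let H := theta_pendant (g./2) (uphalf g) (uphalf g)
             (n + 1 - uphalf (3 * g))%N in
  rho alpha G <= rho alpha H /\
  (rho alpha G = rho alpha H <-> isomorphic G H).
Proof.
move=> H; have [alpha_ge alpha_lt1] := andP halpha.
have [[c [c_gt2 _] size_c] girth_ge_g] := girthG.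
have g_ge3 : (2 < g)%N by rewrite -size_c.
have [[_ connG] edgesG] := hG.
have candG : candidate g (@adj G).
  split; [exact: adj_sym | exact: adj_irrefl | exact: connG | | ].
    by rewrite sum_adj edgesG mulnSr.
  by move=> d d_gt2 cyc; apply: girth_ge_g.
have rhoG : rho alpha G = rho alpha (candidate_graph candG) by [].
(* Relations are coded by finite functions, so that a candidate with maximal [rho] exists by
   finiteness. The value 0 off the candidates is a dummy, as the maximum is taken over candidates
   only. *)
pose rel_of (f : {ffun G * G -> bool}) : rel G := fun a b => f (a, b).
pose value f := if pselect (candidate g (rel_of f)) is left cand_f
  then rho alpha (candidate_graph cand_f) else 0.
have [e [cand_e max_e]] : exists e : rel G, exists cand_e : candidate g e,
    forall (e' : rel G) (cand_e' : candidate g e'),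
      rho alpha (candidate_graph cand_e') <= rho alpha (candidate_graph cand_e).
  have rel_ofK (e : rel G) : rel_of [ffun p => e p.1 p.2] = e.
    by apply/funext => a; apply/funext => b; rewrite /rel_of ffunE.
  (* [candidate_graph] carries the proof of candidacy, on which [rho] must be seen not to depend. *)
  have rho_irrel (e1 e2 : rel G) (c1 : candidate g e1) (c2 : candidate g e2) :
      e1 = e2 -> rho alpha (candidate_graph c1) = rho alpha (candidate_graph c2).
    move=> eq12; case: e2 / eq12 c2 => c2; congr (rho alpha (candidate_graph _)).
    exact: Prop_irrelevance.
  have P0 : `[< candidate g (rel_of [ffun p => adj p.1 p.2]) >].
    by apply/asboolP; rewrite rel_ofK.
  case: (@arg_maxP _ _ _ _ (fun f => `[< candidate g (rel_of f) >]) value P0)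
    => f /asboolP cand_f max_f.
  exists (rel_of f), cand_f => e' cand_e'.
  have cand_e'' : candidate g (rel_of [ffun p => e' p.1 p.2]) by rewrite rel_ofK.
  have Pe' : `[< candidate g (rel_of [ffun p => e' p.1 p.2]) >] by apply/asboolP.
  have := max_f _ Pe'; rewrite /value.
  case: pselect => [c2|no_c2]; last case: (no_c2 cand_f).
  case: pselect => [c1|no_c1]; last case: (no_c1 cand_e'').
  by rewrite (rho_irrel _ _ c1 cand_e' (rel_ofK e')) (rho_irrel _ _ c2 cand_f erefl).
have rho_e : rho alpha (candidate_graph cand_e) = rho alpha H.
  apply: rho_isomorphic; rewrite /H -ordG.
  exact: (maximal_isomorphic alpha_ge alpha_lt1 g_ge3 max_e).
split; first by rewrite -rho_e; apply: max_e candG.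
split=> [rhoGH|]; last exact: rho_isomorphic.
(* In the case of equality [G] is itself a maximal candidate. *)
have := @maximal_isomorphic R alpha G g alpha_ge alpha_lt1 g_ge3 _ candG.
rewrite ordG; apply=> e' cand_e'.
by rewrite -rhoG rhoGH -rho_e; apply: max_e.
Qed.
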